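(* Let $\mathbf n=(n_1,\ldots,n_k)\in\mathbb N^k$ be such that $k\ge2$ and $n_i\ge2$ for all $i\in\{1,\ldots,k\}$. Then, for each $t\in(0,1)$, there exists an uncountable family $\{T^{(\omega)}(t)\}_{\omega\in\Omega}$ of pure elements in the regular polyball $\mathbf B_{\mathbf n}$ with the following properties: (i) $T^{(\omega)}(t)$ is not unitarily equivalent to $T^{(\sigma)}(t)$ for any $\omega,\sigma\in\Omega$, $\omega\ne\sigma$; (ii) $\mathrm{rank}[T^{(\omega)}(t)]=1$ and $\chi[T^{(\omega)}(t)]=t$ for all $\omega\in\Omega$.
   Context: All Hilbert spaces are complex. $B(\mathcal H)^{n_1}\times_c\cdots\times_cB(\mathcal H)^{n_k}$ is the set of tuples $\mathbf X=(X_1,\ldots,X_k)$, $X_i=(X_{i,1},\ldots,X_{i,n_i})\in B(\mathcal H)^{n_i}$, such that every entry of $X_s$ commutes with every entry of $X_t$ for $s\ne t$ (entries of one $X_i$ need not commute). $\Phi_{X_i}(Y):=\sum_{j=1}^{n_i}X_{i,j}YX_{i,j}^*$, and for $\mathbf p\in\{0,1\}^k$, $\mathbf\Delta_{\mathbf X}^{\mathbf p}:=(id-\Phi_{X_1})^{p_1}\circ\cdots\circ(id-\Phi_{X_k})^{p_k}$. $\mathbf B_{\mathbf n}(\mathcal H)$ is the set of such $\mathbf X$ with $\mathbf\Delta_{\mathbf X}^{\mathbf p}(I)\ge0$ for all $\mathbf p\in\{0,1\}^k$, and $\mathbf B_{\mathbf n}=\{\mathbf B_{\mathbf n}(\mathcal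 H):\mathcal H\text{ a Hilbert space}\}$; an element of $\mathbf B_{\mathbf n}$ is an element of some $\mathbf B_{\mathbf n}(\mathcal H)$. $\mathbf X$ is pure if $\Phi_{X_i}^p(I)\to0$ strongly as $p\to\infty$ for each $i$. The defect operator is $\mathbf\Delta_{\mathbf X}(I):=(id-\Phi_{X_1})\circ\cdots\circ(id-\Phi_{X_k})(I)$, and $\mathrm{rank}[\mathbf X]$ is the rank of $\mathbf\Delta_{\mathbf X}(I)$. Tuples $\mathbf X$ on $\mathcal H$ and $\mathbf X'$ on $\mathcal H'$ are unitarily equivalent if there is a unitary $W:\mathcal H\to\mathcal H'$ with $WX_{i,j}=X'_{i,j}W$ for all $i,j$. $\mathbb F_{n_i}^+$ is the unital free semigroup on generators $g_1^i,\ldots,g_{n_i}^i$ with identity $g_0^i$, $|\alpha|$ denotes word length, $X_{i,\alpha}:=X_{i,j_1}\cdots X_{i,j_p}$ for $\alpha=g^i_{j_1}\cdots g^i_{j_p}$, $X_{i,g_0^i}:=I$. For $\mathbf q\in\mathbb Z_+^k$, $M_{\mathbf q}(\mathbf X):=\mathrm{span}\{X_{1,\alpha_1}\cdots X_{k,\alpha_k}h:|\alpha_i|\le q_i,\ h\in\mathbf\Delta_{\mathbf X}(I)(\mathcal H)\}$. The Euler characteristic of $\mathbf X$ with finite rank defect is $$\chi(\mathbf X):=\lim_{m\to\infty}\frac{\dim M_{\mathbf q^{(m)}}(\mathbf X)}{\prod_{i=1}^k(1+n_i+\cdots+n_i^{q_i^{(m)}})}$$ for any increasing cofinal sequence $\mathbf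 q^{(m)}$ in $\mathbb Z_+^k$ (the limit exists and is independent of the sequence). *)

(* Defs.v *)
From HB Require Import structures.
From mathcomp Require Import all_boot all_order all_algebra.
From mathcomp Require Import complex.
From mathcomp Require Import all_classical all_reals all_analysis.

Set Implicit Arguments.
Unset Strict Implicit.
Unset Printing Implicit Defensive.

Import Order.TTheory GRing.Theory Num.Theory.
Import numFieldNormedType.Exports.

Local Open Scope classical_set_scope.
Local Open Scope ring_scope.

(* The form is linear in its first argument and conjugate-linear in its
   second. *)
Record hilbert (R : realType) := Hilbert {
  hilbert_carrier :> completeNormedModType R[i];
  inner : {dot hilbert_carrier for Num.conj};
  innerE : forall x, inner x x = `|x| ^+ 2
}.
Arguments inner {R h}.

Record bounded_op (R : realType) (H : hilbert R) := BoundedOp {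
  op_fun :> {linear H -> H};
  op_bounded : exists M : R[i], forall x, `|op_fun x| <= M * `|x|
}.

Section operators.
Context (R : realType) (H : hilbert R).

(* For a bounded operator the Riesz representation theorem provides, for each
   y, exactly one z satisfying the condition. *)
Definition adjoint (A : H -> H) : H -> H :=
  fun y => xget 0 [set z | forall x, inner (A x) y = inner x z].

(* In the order of R[i], 0 <= z means that z is real and nonnegative. *)
Definition positive_op (A : H -> H) := forall h, 0 <= inner (A h) h.

Definition lin_span (S : set H) : set H :=
  [set v | exists (m : nat) (c : 'I_m -> R[i]) (e : 'I_m -> H),
     (forall i, S (e i)) /\ v = \sum_(i < m) c i *: e i].

Definition lin_indep (d : nat) (e : 'I_d -> H) :=
  forall c : 'I_d -> R[i], \sum_(i < d) c i *: e i = 0 -> forall i, c i = 0.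

Definition has_dim (V : set H) (d : nat) :=
  exists e : 'I_d -> H, lin_indep e /\ V = lin_span (range e).

Definition fin_dim (V : set H) := exists d, has_dim V d.

(* By convention 0 if V is not a finite-dimensional subspace. *)
Definition dim (V : set H) : nat := xget 0%N (has_dim V).

Definition Phi (m : nat) (A : 'I_m -> bounded_op H) (Y : H -> H) : H -> H :=
  fun h => \sum_(j < m) A j (Y (adjoint (A j) h)).

Fixpoint word_op (m : nat) (A : 'I_m -> bounded_op H) (alpha : seq 'I_m) :
    H -> H :=
  if alpha is j :: beta then A j \o word_op A beta else id.

End operators.

Section polyball.
Context (R : realType) (k : nat) (n : 'I_k -> nat).

Definition op_tuple (H : hilbert R) := forall i : 'I_k, 'I_(n i) -> bounded_op H.

Section tuple.
Context (H : hilbert R) (X : op_tuple H).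
Arguments X : clear implicits.

Definition commuting_tuple := forall s t : 'I_k, s != t ->
  forall (a : 'I_(n s)) (b : 'I_(n t)), X s a \o X t b =1 X t b \o X s a.

Definition Delta (p : 'I_k -> bool) : (H -> H) -> (H -> H) :=
  \big[(fun F G => F \o G)/id]_(i < k)
    iter (p i) (fun Y => Y \- Phi (X i) Y).

Definition in_polyball :=
  commuting_tuple /\ forall p, positive_op (Delta p id).

Definition pure_tuple := forall (i : 'I_k) (h : H),
  iter p (Phi (X i)) id h @[p --> \oo] --> (0 : H).

Definition defect : H -> H := Delta (fun=> true) id.

Definition finite_rank := fin_dim (range defect).

Definition rank : nat := dim (range defect).

Definition M_space (q : 'I_k -> nat) : set H :=
  lin_span [set v | exists (alpha : forall i : 'I_k, seq 'I_(n i)) (h : H),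
    (forall i, (size (alpha i) <= q i)%N) /\
    v = (\big[(fun F G => F \o G)/id]_(i < k) word_op (X i) (alpha i))
          (defect h)].

Definition increasing_cofinal (q : nat -> 'I_k -> nat) :=
  (forall m i, (q m i <= q m.+1 i)%N) /\
  (forall r : 'I_k -> nat, exists m, forall i, (r i <= q m i)%N).

(* The defining limit exists and equals c along every admissible sequence. *)
Definition has_euler_characteristic (c : R) :=
  finite_rank /\
  forall q, increasing_cofinal q ->
    (dim (M_space (q m)))%:R /
      (\prod_(i < k) \sum_(j < (q m i).+1) n i ^ j)%N%:R
      @[m --> \oo] --> c.

End tuple.

Definition unitarily_equivalent (H H' : hilbert R)
    (X : op_tuple H) (X' : op_tuple H') :=
  exists W : {linear H -> H'},
    [/\ (forall y, exists x, W x = y),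
        (forall x y, inner (W x) (W y) = inner x y) &
        forall i j h, W (X i j h) = X' i j (W h)].

Record polyball := Polyball {
  polyball_space : hilbert R;
  polyball_tuple :> op_tuple polyball_space;
  polyballP : in_polyball polyball_tuple
}.

End polyball.
Arguments polyball_tuple {R k n} p i _.

(* Main.v *)
Require Import Defs.
From HB Require Import structures.
From mathcomp Require Import all_boot all_order all_algebra.
From mathcomp Require Import finmap complex.
From mathcomp Require Import all_classical all_reals all_analysis.
From mathcomp Require summability.
From mathcomp Require Import ring lra zify.
Set Implicit Arguments.
Unset Strict Implicit.
Unset Printing Implicit Defensive.
Import Order.TTheory GRing.Theory Num.Theory.
Import numFieldNormedType.Exports.
Local Open Scope classical_set_scope.
Local Open Scope ring_scope.

(** Compress the left creation operators of the full Fock space with orthonormal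
    basis the k-tuples of words [w = (w_1, ..., w_k)] to the span of a set of
    such tuples that is closed under removing first letters in each coordinate.
    The compressed operator [X_{i,j}] sends the basis vector of [w] to that of
    the tuple with letter [j] put in front of [w_i], or to 0 if this tuple has
    been left out. All the objects of the theorem then become combinatorial.
    [Phi_{X_i}] maps a coordinate projection to a coordinate projection (lemma
    [Phi_restrict]); hence [Delta^p(I)] is the projection onto the tuples with
    [w_i] empty whenever [p_i = 1] ([Delta_restrict]), which is positive, and
    [Phi_{X_i}^m(I)] is the projection onto the tuples with [|w_i| >= m], which
    tends strongly to 0. The defect is the rank one projection onto the vector
    of the empty tuple, and [M_q] is spanned by the basis vectors of the tuples
    with [|w_i| <= q_i] ([M_space_dim]). So the Euler characteristic is the
    asymptotic density of the set of tuples.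

    It is enough to restrict one coordinate: only the words in that coordinate
    are required to lie in a set [T] containing the empty word and closed under
    removing the first letter (a [tree]); then the Euler characteristic is the
    density of [T] among all words over [n] letters ([tree_tuple_euler]). Read
    a word as the base-[n] digits, least significant first, of an n-adic
    subinterval of [[0,1]]: prepending a letter passes to a subinterval. The
    words whose interval meets the interval from [s] to [s + t] form a tree, and
    at each level their number is [t n^l] up to 2, so that the density is [t]
    ([interval_tree_density]).

    The tree is a unitary invariant. A unitary that intertwines two such tuples
    also intertwines the adjoints, so it maps the vector of the empty tuple,
    which up to a scalar is the only one killed by all the adjoints, to a
    multiple of its counterpart; and a word [alpha] is in the tree exactly when
    [X_alpha] does not kill that vector ([tree_tuple_unitary_invariant]).
    Letting [s] range over the uncountable interval [[0, 1 - t]] gives the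
    family.

    The Hilbert space is the space [l2] of square summable families of complex
    numbers, which is constructed first; unordered sums make the inner product
    invariant under reindexing by partial injections, and this gives the
    adjoints of the operators above ([inner_shift]). *)

(** * Unordered sums of real families *)

Section unordered_sum.
Context {R : realType} {I : choiceType}.
Implicit Types (g h : I -> R) (A B : {fset I}).

#[local] Existing Instance summability.totally_filter.
Local Notation totally := (@summability.totally I).

(** Stating the partial sums as a function on finite sets, and not on the
    underlying lists, keeps the filter below on the type of finite sets. *)
Definition fsum g (A : {fset I}) : R := \sum_(i <- A) g i.

Definition usum g : R := lim (fsum g @ totally).

Definition abs_summable g :=
  exists M, forall A, \sum_(i <- A) `|g i| <= M.

Lemma totally_above A : \forall B \near totally, (A `<=` B)%fset.
Proof. by exists A. Qed.

Lemma sub_sum_ge0 g A B : (forall i, 0 <= g i) -> (A `<=` B)%fset ->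
  \sum_(i <- A) g i <= \sum_(i <- B) g i.
Proof.
move=> g0 AB; rewrite (big_fsetID _ [pred i | i \in A] B) /=.
have -> : [fset x in B | x \in A]%fset = A.
  apply/fsetP => x; rewrite !inE /= andbC.
  by case: (boolP (x \in A)) => //= /(fsubsetP AB).
by rewrite lerDl sumr_ge0.
Qed.

Lemma ge0_cvg_usum g M : (forall i, 0 <= g i) ->
  (forall A, \sum_(i <- A) g i <= M) ->
  cvg (fsum g @ totally).
Proof.
move=> g0 gM; set S := range (fun A => \sum_(i <- A) g i).
have supS : has_sup S.
  split; first by exists (\sum_(i <- fset0) g i); exists fset0.
  by exists M => _ [A _ <-].
apply/cvg_ex; exists (sup S); apply/cvgrPdist_le => e e0.
have [_ [A _ <-] ltA] := sup_adherent e0 supS.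
exists A => // B /= AB.
have leB : \sum_(i <- B) g i <= sup S by apply: sup_upper_bound => //; exists B.
rewrite ger0_norm ?subr_ge0// lerBlDr -lerBlDl.
by apply: (le_trans (ltW ltA)); apply: sub_sum_ge0.
Qed.

Lemma abs_summable_norm g : abs_summable g -> abs_summable (fun i => `|g i|).
Proof. by move=> [M gM]; exists M => A; under eq_bigr do rewrite normr_id. Qed.

Lemma abs_summable_le g h :
  (forall i, `|g i| <= h i) -> abs_summable h -> abs_summable g.
Proof.
move=> gh [M hM]; exists M => A; apply: le_trans (hM A).
by apply: ler_sum => i _; apply: le_trans (gh i) (ler_norm _).
Qed.

Lemma abs_summableD g h : abs_summable g -> abs_summable h ->
  abs_summable (fun i => g i + h i).
Proof.
move=> [M gM] [N hN]; exists (M + N) => A; apply: le_trans (lerD (gM A) (hN A)).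
by rewrite -big_split; apply: ler_sum => i _; apply: ler_normD.
Qed.

Lemma abs_summableZ c g : abs_summable g -> abs_summable (fun i => c * g i).
Proof.
move=> [M gM]; exists (`|c| * M) => A; under eq_bigr do rewrite normrM.
by rewrite -mulr_sumr ler_wpM2l.
Qed.

(** A summable family is the difference of the nonnegative families
    [g + |g|] and [|g|], whose partial sums are increasing and bounded. *)
Lemma cvg_usum g : abs_summable g ->
  cvg (fsum g @ totally).
Proof.
move=> gS; have [M gM] := gS.
have [N hN] := abs_summableD gS (abs_summable_norm gS).
have c1 : cvg (fsum (fun i => g i + `|g i|) @ totally).
  apply: (@ge0_cvg_usum _ N) => [i|A].
    by rewrite -lerBlDr sub0r lerNnormlW.
  by apply: le_trans (hN A); apply: ler_sum => i _; apply: ler_norm.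
have c2 : cvg (fsum (fun i => `|g i|) @ totally).
  exact: (@ge0_cvg_usum _ M).
rewrite (_ : fsum g = fsum (fun i => g i + `|g i|) \- fsum (fun i => `|g i|)).
  exact: is_cvgB.
by apply/funext => A; rewrite /fsum /= big_split /= addrK.
Qed.

Lemma eq_usum g h : g =1 h -> usum g = usum h.
Proof. by move=> /funext ->. Qed.

Lemma usumD g h : abs_summable g -> abs_summable h ->
  usum (fun i => g i + h i) = usum g + usum h.
Proof.
move=> gS hS; apply/cvg_lim => //.
rewrite (_ : fsum _ = fsum g \+ fsum h).
  by apply: cvgD; apply: cvg_usum.
by apply/funext => A; rewrite /fsum big_split.
Qed.

Lemma usumZ c g : abs_summable g -> usum (fun i => c * g i) = c * usum g.
Proof.
move=> gS; rewrite /usum.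
rewrite (_ : fsum (fun i => c * g i) = (fun A => c * fsum g A)); last first.
  by apply/funext => A; rewrite /fsum mulr_sumr.
by apply/cvg_lim => //; apply: cvgMr; apply: cvg_usum.
Qed.

Lemma ge0_abs_summable g M : (forall i, 0 <= g i) ->
  (forall A, \sum_(i <- A) g i <= M) -> abs_summable g.
Proof. by move=> g0 gM; exists M => A; under eq_bigr do rewrite ger0_norm //. Qed.

Lemma usum_le g M : abs_summable g -> (forall A, \sum_(i <- A) g i <= M) ->
  usum g <= M.
Proof.
by move=> gS gM; apply: limr_le; [exact: cvg_usum|exact: nearW].
Qed.

Lemma sum_le_usum g A : abs_summable g -> (forall i, 0 <= g i) ->
  \sum_(i <- A) g i <= usum g.
Proof.
move=> gS g0; apply: limr_ge; first exact: cvg_usum.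
by near=> B; apply: sub_sum_ge0 => //; near: B; apply: totally_above.
Unshelve. all: by end_near. Qed.

Lemma usum_ge0 g : abs_summable g -> (forall i, 0 <= g i) -> 0 <= usum g.
Proof. by move=> gS g0; have := sum_le_usum fset0 gS g0; rewrite big_nil. Qed.

(** The two functions describe a bijection between subsets of [I]; outside
    these subsets they take the value [None]. *)
Definition partial_inverse (phi psi : I -> option I) :=
  forall a b, phi a = Some b <-> psi b = Some a.

Lemma partial_inverse_sym phi psi :
  partial_inverse phi psi -> partial_inverse psi phi.
Proof. by move=> inv a b; split=> [/inv|/inv]. Qed.

(** The terms of the left-hand sum with [psi b = None] vanish; the others are
    reindexed by [a = psi b]. *)
Lemma sum_partial_inverse phi psi (F : I -> I -> R) A :
  partial_inverse phi psi ->
  \sum_(b <- A) oapp (F^~ b) 0 (psi b) =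
  \sum_(a <- [fset a in pmap psi A]%fset) oapp (F a) 0 (phi a).
Proof.
move=> inv.
have uniqA (s : seq I) : uniq s -> uniq (pmap psi s).
  elim: s => //= b s IH /andP[bs us].
  case psib: (psi b) => [a|] /=; last exact: IH.
  rewrite IH // andbT mem_pmap; apply: contra bs => /mapP[b' b's psib'].
  have /inv := psib; have /inv := esym psib'.
  by move=> -> [<-].
have -> : \sum_(a <- [fset a in pmap psi A]%fset) oapp (F a) 0 (phi a) =
    \sum_(a <- pmap psi A) oapp (F a) 0 (phi a).
  apply: perm_big; apply: uniq_perm; [exact: fset_uniq|exact: uniqA|].
  by move=> a; rewrite !inE.
rewrite big_pmap; apply: eq_bigr => b _.
by case psib: (psi b) => [a|] //=; have /inv -> := psib.
Qed.

Let norm_oapp (H : I -> R) o :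
  `|oapp H 0 o| = oapp (fun x => `|H x|) 0 o.
Proof. by case: o => //=; rewrite normr0. Qed.

Let add_norm_oapp (H : I -> R) o :
  oapp H 0 o + `|oapp H 0 o| = oapp (fun x => H x + `|H x|) 0 o.
Proof. by case: o => //=; rewrite normr0 addr0. Qed.

Lemma abs_summable_partial_inverse phi psi (F : I -> I -> R) :
  partial_inverse phi psi ->
  abs_summable (fun a => oapp (F a) 0 (phi a)) ->
  abs_summable (fun b => oapp (F^~ b) 0 (psi b)).
Proof.
move=> inv [M hM]; exists M => A; under eq_bigr do rewrite norm_oapp.
have := sum_partial_inverse (fun a b => `|F a b|) A inv => /= ->.
by apply: le_trans (hM _); apply: ler_sum => a _; rewrite norm_oapp.
Qed.

(* For nonnegative terms every partial sum on one side is a partial sum on the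
   other one, which bounds the total; exchanging the sides gives equality. *)
Let ge0_usum_le phi psi (F : I -> I -> R) : partial_inverse phi psi ->
  (forall a b, 0 <= F a b) -> abs_summable (fun a => oapp (F a) 0 (phi a)) ->
  usum (fun b => oapp (F^~ b) 0 (psi b)) <= usum (fun a => oapp (F a) 0 (phi a)).
Proof.
move=> inv F0 FS; apply: usum_le => [|A].
  exact: abs_summable_partial_inverse FS.
rewrite (sum_partial_inverse F A inv).
by apply: sum_le_usum => // a; case: (phi a) => /=.
Qed.

Let ge0_usum_eq phi psi (F : I -> I -> R) : partial_inverse phi psi ->
  (forall a b, 0 <= F a b) -> abs_summable (fun a => oapp (F a) 0 (phi a)) ->
  usum (fun b => oapp (F^~ b) 0 (psi b)) = usum (fun a => oapp (F a) 0 (phi a)).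
Proof.
move=> inv F0 FS; apply/eqP; rewrite eq_le ge0_usum_le //=.
apply: (@ge0_usum_le _ _ (fun a b => F b a)) => //.
  exact: partial_inverse_sym.
exact: abs_summable_partial_inverse FS.
Qed.

Lemma usum_partial_inverse phi psi (F : I -> I -> R) :
  partial_inverse phi psi ->
  abs_summable (fun a => oapp (F a) 0 (phi a)) ->
  usum (fun b => oapp (F^~ b) 0 (psi b)) = usum (fun a => oapp (F a) 0 (phi a)).
Proof.
move=> inv FS; have FS' := abs_summable_partial_inverse inv FS.
have [nFS nFS'] := (abs_summable_norm FS, abs_summable_norm FS').
have split_usum (g : I -> R) : abs_summable g ->
    usum g = usum (fun i => g i + `|g i|) - usum (fun i => `|g i|).
  by move=> gS; rewrite usumD ?addrK//; apply: abs_summable_norm.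
rewrite (split_usum _ FS) (split_usum _ FS'); congr (_ - _).
  rewrite (eq_usum (fun b => add_norm_oapp _ _)).
  rewrite [RHS](eq_usum (fun b => add_norm_oapp _ _)).
  apply: (@ge0_usum_eq _ _ (fun a b => F a b + `|F a b|)) => // [a b|].
    by rewrite -lerBlDr sub0r lerNnormlW.
  have := abs_summableD FS nFS.
  by under [X in abs_summable X]funext do rewrite add_norm_oapp.
rewrite (eq_usum (fun b => norm_oapp _ _)).
rewrite [RHS](eq_usum (fun b => norm_oapp _ _)).
apply: (@ge0_usum_eq _ _ (fun a b => `|F a b|)) => //.
by move: nFS; under [X in abs_summable X]funext do rewrite norm_oapp.
Qed.

End unordered_sum.

(** * Unordered sums of complex families *)

Section complex_sum.
Context {R : realType} {I : choiceType}.
Implicit Types (f g h : I -> R[i]) (c z : R[i]).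

Definition csummable h := abs_summable (fun i => complex.Re (h i)) /\
  abs_summable (fun i => complex.Im (h i)).

Definition csum h : R[i] :=
  Complex (usum (fun i => complex.Re (h i))) (usum (fun i => complex.Im (h i))).

Lemma eq_csum g h : g =1 h -> csum g = csum h.
Proof. by move=> /funext ->. Qed.

Lemma csumD g h : csummable g -> csummable h ->
  csum (fun i => g i + h i) = csum g + csum h.
Proof.
move=> [gr gi] [hr hi]; rewrite /csum.
rewrite -[RHS]/(Complex (usum _ + usum _) (usum _ + usum _)) -!usumD//.
by congr Complex; apply: eq_usum => i; case: (g i) (h i) => [? ?] [? ?].
Qed.

Let ReM z1 z2 : complex.Re (z1 * z2) =
  complex.Re z1 * complex.Re z2 + - complex.Im z1 * complex.Im z2.
Proof. by case: z1 z2 => [? ?] [? ?] /=; rewrite mulNr. Qed.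

Let ImM z1 z2 : complex.Im (z1 * z2) =
  complex.Re z1 * complex.Im z2 + complex.Im z1 * complex.Re z2.
Proof. by case: z1 z2 => [? ?] [? ?] /=; rewrite addrC. Qed.

Lemma csumZ c h : csummable h -> csum (fun i => c * h i) = c * csum h.
Proof.
move=> [hr hi]; rewrite /csum [RHS](_ : _ = Complex
    (complex.Re c * usum (fun i => complex.Re (h i))
      + - complex.Im c * usum (fun i => complex.Im (h i)))
    (complex.Re c * usum (fun i => complex.Im (h i))
      + complex.Im c * usum (fun i => complex.Re (h i)))).
  rewrite -!usumZ// -!usumD; try exact: abs_summableZ.
  by congr Complex; apply: eq_usum => i; rewrite ?ReM ?ImM.
by apply/eqP; rewrite eq_complex ReM ImM /= !eqxx.
Qed.

Lemma csum_conj h : csummable h -> csum (fun i => (h i)^*) = (csum h)^*.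
Proof.
move=> [hr hi].
have conjE z : z^* = Complex (complex.Re z) (-1 * complex.Im z).
  by case: z => a b; rewrite mulN1r.
rewrite conjE /= -usumZ//.
by congr Complex; apply: eq_usum => i; rewrite conjE.
Qed.

Lemma csum_partial_inverse (phi psi : I -> option I) (F : I -> I -> R[i]) :
  partial_inverse phi psi ->
  csummable (fun a => oapp (F a) 0 (phi a)) ->
  csum (fun b => oapp (F^~ b) 0 (psi b)) = csum (fun a => oapp (F a) 0 (phi a)).
Proof.
move=> inv [].
have oappE (G : R[i] -> R) (H : I -> R[i]) o : G 0 = 0 ->
  G (oapp H 0 o) = oapp (fun x => G (H x)) 0 o by case: o.
under [X in abs_summable X]funext do rewrite oappE//.
move=> hr; under [X in abs_summable X]funext do rewrite oappE//.
move=> hi; congr Complex.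
  rewrite (eq_usum (fun b => oappE (@complex.Re R) _ _ erefl)).
  rewrite [RHS](eq_usum (fun b => oappE (@complex.Re R) _ _ erefl)).
  exact: (usum_partial_inverse (F := fun a b => complex.Re (F a b))).
rewrite (eq_usum (fun b => oappE (@complex.Im R) _ _ erefl)).
rewrite [RHS](eq_usum (fun b => oappE (@complex.Im R) _ _ erefl)).
exact: (usum_partial_inverse (F := fun a b => complex.Im (F a b))).
Qed.

(** The square of the modulus, as an element of [R]: the norm of [R[i]] takes
    its values in [R[i]]. *)
Definition sqmod z : R := complex.Re z ^+ 2 + complex.Im z ^+ 2.

Lemma sqmod_ge0 z : 0 <= sqmod z.
Proof. by rewrite addr_ge0 ?sqr_ge0. Qed.

Lemma sqmod0 : sqmod 0 = 0.
Proof. by rewrite /sqmod /= expr0n addr0. Qed.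

Lemma sqmod_eq0 z : sqmod z = 0 -> z = 0.
Proof.
case: z => a b /eqP; rewrite paddr_eq0 ?sqr_ge0// !sqrf_eq0 /=.
by move=> /andP[/eqP -> /eqP ->].
Qed.

Lemma sqmodM z1 z2 : sqmod (z1 * z2) = sqmod z1 * sqmod z2.
Proof. by rewrite /sqmod ReM ImM; ring. Qed.

Lemma sqmodD_le z1 z2 : sqmod (z1 + z2) <= 2 * (sqmod z1 + sqmod z2).
Proof.
case: z1 z2 => [a b] [c d]; rewrite /sqmod /= -subr_ge0.
rewrite [leRHS](_ : _ = (a - c) ^+ 2 + (b - d) ^+ 2); last by ring.
by rewrite addr_ge0 ?sqr_ge0.
Qed.

Lemma mul_conjE z1 z2 : z1 * z2^* = Complex
  (complex.Re z1 * complex.Re z2 + complex.Im z1 * complex.Im z2)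
  (complex.Im z1 * complex.Re z2 - complex.Re z1 * complex.Im z2).
Proof.
by case: z1 z2 => [a b] [c d]; apply/eqP; rewrite eq_complex /=; apply/andP; split;
  apply/eqP; ring.
Qed.

Definition square_summable f := abs_summable (fun i => sqmod (f i)).

Let norm_cross_le (a b c d : R) :
  `|a * b + c * d| <= (a ^+ 2 + c ^+ 2) + (b ^+ 2 + d ^+ 2).
Proof.
have := (sqr_ge0 a, sqr_ge0 b, sqr_ge0 c, sqr_ge0 d, sqr_ge0 (a + b),
  sqr_ge0 (a - b), sqr_ge0 (c + d), sqr_ge0 (c - d)).
move=> [[[[[[[a0 b0] c0] d0] ab] ab'] cd] cd'].
by rewrite ler_norml; apply/andP; split; nra.
Qed.

Lemma csummable_mul_conj f g : square_summable f -> square_summable g ->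
  csummable (fun i => f i * (g i)^*).
Proof.
move=> fS gS; have fgS := abs_summableD fS gS.
split; apply: abs_summable_le fgS => i; rewrite mul_conjE /sqmod /=.
  exact: norm_cross_le.
by rewrite -mulrN -(sqrrN (complex.Im (g i))) addrC
  [X in _ <= _ + X]addrC norm_cross_le.
Qed.

End complex_sum.

(** * The Hilbert space of square summable families *)

Section l2_space.
Context (R : realType) (I : choiceType).

Definition l2_pred : {pred I -> R[i]^o} := fun f => `[< square_summable f >].

Lemma l2_submod_closed : submod_closed l2_pred.
Proof.
split=> [|c f g /asboolP fS /asboolP gS]; apply/asboolP.
  exists 0 => A; rewrite big1// => i _.
  by rewrite /= sqmod0 normr0.
apply: abs_summable_le (abs_summableZ 2 (abs_summableD
  (abs_summableZ (sqmod c) fS) gS)) => i.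
by rewrite ger0_norm ?sqmod_ge0// (le_trans (sqmodD_le _ _))// sqmodM.
Qed.

HB.instance Definition _ :=
  GRing.isSubmodClosed.Build R[i] (I -> R[i]^o) l2_pred l2_submod_closed.

Record l2 := L2 { l2_fun :> I -> R[i]^o; l2_funP : l2_fun \in l2_pred }.

HB.instance Definition _ := [isSub for l2_fun].
HB.instance Definition _ := [Choice of l2 by <:].
HB.instance Definition _ := [SubChoice_isSubLmodule of l2 by <:].

Implicit Types f g : l2.

Lemma l2_summable f : square_summable f.
Proof. by apply/asboolP; exact: l2_funP. Qed.

Lemma l2_ext f g : f =1 g -> f = g.
Proof. by move=> fg; apply/val_inj/funext. Qed.

Lemma l2D f g i : (f + g) i = f i + g i. Proof. by []. Qed.
Lemma l2B f g i : (f - g) i = f i - g i. Proof. by []. Qed.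
Lemma l2Z c f i : (c *: f) i = c * f i. Proof. by []. Qed.
Lemma l2_sum (J : Type) (r : seq J) (P : pred J) (F : J -> l2) i :
  (\sum_(j <- r | P j) F j) i = \sum_(j <- r | P j) F j i.
Proof. by apply: (big_morph (fun f : l2 => f i)). Qed.

Definition l2_inner f g : R[i] :=
  csum (fun i => (f i : R[i]) * (g i : R[i])^*).

Let innerS f g : csummable (fun i => (f i : R[i]) * (g i : R[i])^*).
Proof. by apply: csummable_mul_conj; exact: l2_summable. Qed.

Lemma l2_innerC f g : l2_inner f g = (-1) ^+ false * (l2_inner g f)^*.
Proof.
rewrite expr0 mul1r -csum_conj//.
by apply: eq_csum => i; rewrite rmorphM /= conjCK mulrC.
Qed.

Lemma l2_inner_linearl g :
  linear_for *%R (l2_inner ^~ g).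
Proof.
move=> c f f'; rewrite /l2_inner -csumZ// -csumD//.
  by apply: eq_csum => i; rewrite l2D l2Z mulrDl mulrA.
have := innerS (c *: f) g.
by under [X in csummable X]funext do rewrite l2Z -mulrA.
Qed.

Lemma l2_inner_linearr f :
  linear_for (Num.conj \; *%R) (l2_inner f).
Proof.
move=> c g g'; rewrite l2_innerC l2_inner_linearl /= !mul1r rmorphD rmorphM /=.
by rewrite [l2_inner f g]l2_innerC [l2_inner f g']l2_innerC !mul1r.
Qed.

Definition l2_sqnorm f : R := usum (fun i => sqmod (f i)).

Lemma l2_innerE f : l2_inner f f = (l2_sqnorm f)%:C%C.
Proof.
congr Complex; first by apply: eq_usum => i; rewrite mul_conjE /sqmod /= -!expr2.
rewrite (@eq_usum _ _ _ (fun i => 0 * sqmod (f i))) => [|i].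
  by rewrite usumZ ?mul0r//; exact: l2_summable.
by rewrite mul_conjE /= mulrC subrr mul0r.
Qed.

Lemma l2_sqnorm_ge0 f : 0 <= l2_sqnorm f.
Proof. by apply: usum_ge0 => [|i]; [exact: l2_summable|exact: sqmod_ge0]. Qed.

Lemma sqmod_le_l2_sqnorm f i : sqmod (f i) <= l2_sqnorm f.
Proof.
have := sum_le_usum [fset i]%fset (l2_summable f) (fun i => sqmod_ge0 (f i)).
by rewrite big_seq_fset1.
Qed.

Lemma l2_sqnorm_eq0 f : l2_sqnorm f = 0 -> f = 0.
Proof.
move=> f0; apply: l2_ext => i; apply: sqmod_eq0; apply/eqP.
by rewrite eq_le sqmod_ge0 andbT -f0 sqmod_le_l2_sqnorm.
Qed.

Lemma l2_dnorm_gt0 f : f != 0 -> 0 < l2_inner f f.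
Proof.
rewrite l2_innerE ltcR lt_def l2_sqnorm_ge0 andbT; apply: contraNneq.
by move=> /l2_sqnorm_eq0 ->.
Qed.

HB.instance Definition _ := bilinear_isBilinear.Build R[i] l2 l2 R[i]
  *%R (Num.conj \; *%R) l2_inner (l2_inner_linearl, l2_inner_linearr).
HB.instance Definition _ := isHermitianSesquilinear.Build R[i] l2 false Num.conj
  l2_inner l2_innerC.
HB.instance Definition _ := isDotProduct.Build R[i] l2 l2_inner l2_dnorm_gt0.

Let sqrt_sqnorm0 f : Num.sqrt (l2_sqnorm f) = 0 -> f = 0.
Proof.
move=> /eqP; rewrite sqrtr_eq0 => f0; apply: l2_sqnorm_eq0.
by apply/eqP; rewrite eq_le f0 l2_sqnorm_ge0.
Qed.

(* With p and q the norms of f and g, the triangle inequality follows termwise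
   from |x + y|^2 <= (p + q) (|x|^2 / p + |y|^2 / q), as summing the right-hand
   side gives (p + q)^2. *)
Let sqnorm_triangle f g :
  Num.sqrt (l2_sqnorm (f + g)) <= Num.sqrt (l2_sqnorm f) + Num.sqrt (l2_sqnorm g).
Proof.
set p := Num.sqrt (l2_sqnorm f); set q := Num.sqrt (l2_sqnorm g).
have [p0|p_neq0] := eqVneq p 0.
  by rewrite p0 (sqrt_sqnorm0 p0) !add0r.
have [q0|q_neq0] := eqVneq q 0.
  by rewrite q0 (sqrt_sqnorm0 q0) !addr0.
have p_gt0 : 0 < p by rewrite lt_def p_neq0 sqrtr_ge0.
have q_gt0 : 0 < q by rewrite lt_def q_neq0 sqrtr_ge0.
rewrite -(ger0_norm (ltW (addr_gt0 p_gt0 q_gt0))) -sqrtr_sqr ler_wsqrtr//.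
apply: usum_le => [|A]; first exact: l2_summable.
have le1 i : sqmod ((f + g) i) <=
    (p + q) / p * sqmod (f i) + (p + q) / q * sqmod (g i).
  rewrite l2D; case: (f i) (g i) => [a b] [c d]; rewrite /sqmod /= -subr_ge0.
  rewrite [leRHS](_ : _ = ((q * a - p * c) ^+ 2 + (q * b - p * d) ^+ 2) / (p * q)).
    by rewrite divr_ge0 ?addr_ge0 ?sqr_ge0// mulr_ge0// ltW.
  by field; rewrite ?p_neq0 ?q_neq0.
apply: le_trans (ler_sum _ (fun i _ => le1 i)) _.
rewrite big_split /= -!mulr_sumr.
have fA := sum_le_usum A (l2_summable f) (fun i => sqmod_ge0 (f i)).
have gA := sum_le_usum A (l2_summable g) (fun i => sqmod_ge0 (g i)).
have {}fA : \sum_(i <- A) sqmod (f i) <= p ^+ 2.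
  by rewrite sqr_sqrtr ?l2_sqnorm_ge0.
have {}gA : \sum_(i <- A) sqmod (g i) <= q ^+ 2.
  by rewrite sqr_sqrtr ?l2_sqnorm_ge0.
have pq0 : 0 <= p + q by rewrite addr_ge0// ltW.
have hf : 0 <= (p + q) / p by rewrite divr_ge0// ltW.
have hg : 0 <= (p + q) / q by rewrite divr_ge0// ltW.
apply: le_trans (lerD (ler_wpM2l hf fA) (ler_wpM2l hg gA)) _.
rewrite le_eqVlt; apply/orP; left; apply/eqP.
by field; rewrite ?p_neq0 ?q_neq0.
Qed.

Let sqnormZ c f : l2_sqnorm (c *: f) = sqmod c * l2_sqnorm f.
Proof.
rewrite /l2_sqnorm -usumZ; last exact: l2_summable.
by apply: eq_usum => i; rewrite l2Z sqmodM.
Qed.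

Definition l2_norm f : R[i] := (Num.sqrt (l2_sqnorm f))%:C%C.

Let normD f g : l2_norm (f + g) <= l2_norm f + l2_norm g.
Proof. by rewrite /l2_norm -rmorphD lecR sqnorm_triangle. Qed.

Let normZ c f : l2_norm (c *: f) = `|c| * l2_norm f.
Proof.
rewrite /l2_norm sqnormZ sqrtrM ?sqmod_ge0// normc_def.
by rewrite -rmorphM.
Qed.

Let norm_eq0 f : l2_norm f = 0 -> f = 0.
Proof. by move=> /complexI /sqrt_sqnorm0. Qed.

HB.instance Definition _ := Lmodule_isNormed.Build R[i] l2 normD normZ norm_eq0.

Lemma l2_normE f : `|f| = (Num.sqrt (l2_sqnorm f))%:C%C.
Proof. by []. Qed.

Lemma l2_norm_lt f (e : R) : 0 < e -> (`|f| < e%:C%C) = (l2_sqnorm f < e ^+ 2).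
Proof.
move=> e0; rewrite l2_normE ltcR -{1}[e]ger0_norm ?(ltW e0)// -sqrtr_sqr.
by rewrite ltr_sqrt// exprn_gt0.
Qed.

Lemma l2_innerN f : l2_inner f f = `|f| ^+ 2.
Proof. by rewrite l2_innerE l2_normE -rmorphXn /= sqr_sqrtr ?l2_sqnorm_ge0. Qed.

Lemma l2_coord_lt f i (e : R) : `|f| < e%:C%C ->
  `|complex.Re (f i)| < e /\ `|complex.Im (f i)| < e.
Proof.
rewrite l2_normE ltcR => fe.
have ge : Num.sqrt (sqmod (f i)) < e.
  by apply: le_lt_trans fe; rewrite ler_wsqrtr// sqmod_le_l2_sqnorm.
by split; apply: le_lt_trans ge; rewrite -sqrtr_sqr ler_wsqrtr//
  ?lerDl ?lerDr sqr_ge0.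
Qed.

Let posc_real (e : R[i]) : 0 < e -> exists2 d : R, 0 < d & e = d%:C%C.
Proof.
case: e => a b; rewrite ltcE /= => /andP[/eqP -> a0].
by exists a.
Qed.

(* Finite sums of squared moduli pass to the limit, so a bound on the distance
   from x that holds near F is inherited by the coordinatewise limit of F. *)
Let limit_in_ball (F : set_system l2) (a : I -> R[i]) x (e : R) :
  ProperFilter F -> 0 < e ->
  (forall i, complex.Re ((f : l2) i) @[f --> F] --> complex.Re (a i)) ->
  (forall i, complex.Im ((f : l2) i) @[f --> F] --> complex.Im (a i)) ->
  (\forall f \near F, `|x - f| < e%:C%C) ->
  forall A : {fset I}, \sum_(i <- A) sqmod (x i - a i) <= e ^+ 2.
Proof.
move=> FF e0 cRe cIm near_x A.
have c : \sum_(i <- A) sqmod (x i - (f : l2) i) @[f --> F] -->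
    \sum_(i <- A) sqmod (x i - a i).
  apply: cvg_big => [|i _]; first exact: add_continuous.
  rewrite (_ : (fun f : l2 => _) = fun f : l2 =>
    (complex.Re (x i) - complex.Re (f i)) * (complex.Re (x i) - complex.Re (f i)) +
    (complex.Im (x i) - complex.Im (f i)) * (complex.Im (x i) - complex.Im (f i))).
    rewrite (_ : sqmod _ =
      (complex.Re (x i) - complex.Re (a i)) * (complex.Re (x i) - complex.Re (a i)) +
      (complex.Im (x i) - complex.Im (a i)) * (complex.Im (x i) - complex.Im (a i))).
      by apply: cvgD; apply: cvgM; apply: cvgB => //; apply: cvg_cst.
    by rewrite /sqmod !expr2; case: (x i) (a i) => [? ?] [? ?].
  by apply/funext => f; rewrite /sqmod !expr2; case: (x i) (f i) => [? ?] [? ?].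
have -> : \sum_(i <- A) sqmod (x i - a i) =
    lim (\sum_(i <- A) sqmod (x i - (f : l2) i) @[f --> F]).
  by apply/esym/cvg_lim.
apply: limr_le; first by apply/cvg_ex; exists (\sum_(i <- A) sqmod (x i - a i)).
near=> f; apply: le_trans (sum_le_usum A (l2_summable (x - f)) _) _.
  by move=> i; apply: sqmod_ge0.
by rewrite ltW// -l2_norm_lt//; near: f.
Unshelve. all: by end_near. Qed.

(* The coordinates of a Cauchy filter converge; the limit family is square
   summable because it is at finite distance from some point x1 of the space. *)
Let l2_complete (F : set_system l2) : ProperFilter F -> cauchy F -> cvg F.
Proof.
move=> FF /cauchyP Fc.
have {}Fc (e : R) : 0 < e ->
    exists x : l2, \forall f \near F, `|x - f| < e%:C%C.
  by move=> e0; apply: Fc; rewrite ltcR.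
have cRe i : cvg (complex.Re ((f : l2) i) @[f --> F]).
  apply: cauchy_cvg; apply: cauchy_exP => e e0.
  have [x Fx] := Fc e e0; exists (complex.Re (x i)).
  suff : (\forall f \near F,
    `|complex.Re (x i) - complex.Re ((f : l2) i)| < e) by [].
  near=> f.
  rewrite (_ : _ - _ = complex.Re ((x - f) i)); last first.
    by rewrite l2B; case: (x i) (f i) => [? ?] [? ?].
  by have [] := @l2_coord_lt (x - f) i e => //; near: f.
have cIm i : cvg (complex.Im ((f : l2) i) @[f --> F]).
  apply: cauchy_cvg; apply: cauchy_exP => e e0.
  have [x Fx] := Fc e e0; exists (complex.Im (x i)).
  suff : (\forall f \near F,
    `|complex.Im (x i) - complex.Im ((f : l2) i)| < e) by [].
  near=> f.
  rewrite (_ : _ - _ = complex.Im ((x - f) i)); last first.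
    by rewrite l2B; case: (x i) (f i) => [? ?] [? ?].
  by have [] := @l2_coord_lt (x - f) i e => //; near: f.
pose a i := Complex (lim (complex.Re ((f : l2) i) @[f --> F]))
  (lim (complex.Im ((f : l2) i) @[f --> F])).
have ball_a x (e : R) : 0 < e -> (\forall f \near F, `|x - f| < e%:C%C) ->
    forall A : {fset I}, \sum_(i <- A) sqmod (x i - a i) <= e ^+ 2.
  by move=> e0; apply: (limit_in_ball (a := a)) => //.
have diffS x (e : R) : 0 < e -> (\forall f \near F, `|x - f| < e%:C%C) ->
    square_summable (fun i => x i - a i).
  move=> e0 Fx; apply: (ge0_abs_summable (M := e ^+ 2)) => [i|A].
    exact: sqmod_ge0.
  exact: ball_a Fx A.
have [x1 Fx1] := Fc 1 ltr01.
have d1P : (fun i => x1 i - a i : R[i]^o) \in l2_pred.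
  by apply/asboolP; apply: diffS Fx1.
pose al := x1 - L2 d1P.
have alE i : al i = a i by rewrite /al l2B /= opprB addrC subrK.
apply/cvg_ex; exists al; apply/fcvgrPdist_lt => _ /posc_real[e e0 ->].
have e20 : 0 < e / 2 by rewrite divr_gt0.
have [x Fx] := Fc (e / 2) e20.
have al_x : `|al - x| <= (e / 2)%:C%C.
  rewrite distrC l2_normE lecR -[e / 2]ger0_norm ?(ltW e20)// -sqrtr_sqr.
  apply: ler_wsqrtr.
  apply: usum_le => [|A]; first exact: l2_summable.
  by under eq_bigr do rewrite l2B alE; apply: ball_a Fx A.
near=> f; rewrite -(subrKA x al (- f)).
apply: le_lt_trans (ler_normD _ _) _.
rewrite [ltRHS](_ : _ = (e / 2)%:C%C + (e / 2)%:C%C); last first.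
  by rewrite -rmorphD -splitr.
by rewrite ler_ltD//; near: f.
Unshelve. all: by end_near. Qed.

HB.instance Definition _ := Uniform_isComplete.Build l2 l2_complete.

Definition l2_hilbert : hilbert R := @Hilbert R l2 l2_inner l2_innerN.
End l2_space.

(** * Adjoints, spans and dimensions in a Hilbert space *)

Section hilbert_generalities.
Context (R : realType) (H : hilbert R).
Implicit Types (S : set H) (V : set H).

Lemma inner_ext (x y : H) : (forall z, inner z x = inner z y) -> x = y.
Proof.
move=> xy; apply/eqP; rewrite -subr_eq0 -normr_eq0 -sqrf_eq0 -innerE.
by rewrite linearBr /= xy subrr.
Qed.

Lemma adjoint_eq (A B : H -> H) :
  (forall x y, inner (A x) y = inner x (B y)) -> adjoint A = B.
Proof.
move=> AB; apply/funext => y; apply: xget_unique => [x|z zP]; first exact: AB.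
by apply: inner_ext => x; rewrite -zP AB.
Qed.

Lemma lin_span_sub S v : S v -> lin_span S v.
Proof.
move=> Sv; exists 1%N, (fun=> 1), (fun=> v).
by rewrite big_ord1 scale1r; split.
Qed.

Lemma lin_span0 S : lin_span S 0.
Proof. by exists 0%N, (fun=> 0), (fun=> 0); split=> [[]|]; rewrite ?big_ord0. Qed.

Lemma lin_spanP S (a : R[i]) v w :
  lin_span S v -> lin_span S w -> lin_span S (a *: v + w).
Proof.
move=> [m [c [e [eS ->]]]] [m' [c' [e' [eS' ->]]]].
exists (m + m')%N,
  (fun x => match fintype.split x with inl i => a * c i | inr j => c' j end),
  (fun x => match fintype.split x with inl i => e i | inr j => e' j end); split.
  by move=> x; case: (fintype.split x).
rewrite big_split_ord /= scaler_sumr; congr (_ + _); apply: eq_bigr => i _.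
  by rewrite (unsplitK (inl i)) scalerA.
by rewrite (unsplitK (inr i)).
Qed.

Lemma lin_span_sum S (m : nat) (c : 'I_m -> R[i]) (e : 'I_m -> H) :
  (forall i, lin_span S (e i)) -> lin_span S (\sum_(i < m) c i *: e i).
Proof.
move=> eS; elim/big_ind: _ => [|u v Su Sv|i _]; first exact: lin_span0.
  by rewrite -[u]scale1r; apply: lin_spanP.
by rewrite -[_ *: _]addr0; apply: lin_spanP => //; exact: lin_span0.
Qed.

Lemma lin_span_eq S S' : S `<=` lin_span S' -> S' `<=` lin_span S ->
  lin_span S = lin_span S'.
Proof.
move=> SS' S'S; apply/seteqP; split=> _ [m [c [e [eS ->]]]].
  by apply: lin_span_sum => i; exact: SS'.
by apply: lin_span_sum => i; exact: S'S.
Qed.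

Lemma lin_span_rangeP (d : nat) (e : 'I_d -> H) v : lin_span (range e) v ->
  exists a : 'I_d -> R[i], v = \sum_(i < d) a i *: e i.
Proof.
move=> [m [c [e' [eS ->]]]].
elim/big_ind: _ => [|u w [a ->] [b ->]|i _].
- by exists (fun=> 0); rewrite big1// => i _; rewrite scale0r.
- exists (fun i => a i + b i); rewrite -big_split.
  by apply: eq_bigr => i _; rewrite scalerDl.
have [j _ <-] := eS i; exists (fun l => if l == j then c i else 0).
rewrite (bigD1 j)//= eqxx big1 ?addr0// => l /negbTE ->.
by rewrite scale0r.
Qed.

(** Exchange lemma: if [d > d'], the matrix of coefficients of the [e i] on the
    [e' j] has a nonzero vector in its row kernel, which is a linear relation
    between the [e i]. *)
Lemma lin_indep_le (d d' : nat) (e : 'I_d -> H) (e' : 'I_d' -> H) :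
  lin_indep e -> (forall i, lin_span (range e') (e i)) -> (d <= d')%N.
Proof.
move=> ind sp; rewrite leqNgt; apply/negP => ltd.
pose coef i := projT1 (cid (lin_span_rangeP (sp i))).
have coefE i : e i = \sum_(j < d') coef i j *: e' j.
  by rewrite /coef; case: (cid _).
pose A : 'M[R[i]]_(d, d') := \matrix_(i, j) coef i j.
have : kermx A != 0.
  rewrite -mxrank_eq0 mxrank_ker subn_eq0 -ltnNge.
  by apply: leq_ltn_trans ltd; exact: rank_leq_col.
case/rowV0Pn => u /sub_kermxP uA /eqP; apply.
apply/rowP => i; rewrite [RHS]mxE; apply: (ind (u 0)).
under eq_bigr do rewrite coefE scaler_sumr.
rewrite exchange_big big1// => j _.
have /rowP/(_ j) := uA; rewrite !mxE => uAj.
under eq_bigr do rewrite scalerA.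
rewrite -scaler_suml [X in X *: _](_ : _ = 0) ?scale0r// -[RHS]uAj.
by apply: eq_bigr => l _; rewrite mxE.
Qed.

(** [dim] picks some number of basis vectors of [V]; by the exchange lemma all
    choices agree. *)
Lemma dim_eq V (d : nat) : has_dim V d -> Defs.dim V = d.
Proof.
move=> [e [ind Ve]]; apply: xget_unique; first by exists e.
move=> d' [e' [ind' Ve']]; apply/eqP; rewrite eqn_leq.
apply/andP; split.
  apply: (lin_indep_le (e' := e) ind') => i.
  by rewrite -Ve Ve'; apply: lin_span_sub; exists i.
apply: (lin_indep_le (e' := e') ind) => i.
by rewrite -Ve' Ve; apply: lin_span_sub; exists i.
Qed.

End hilbert_generalities.

(** Surjectivity is what makes the relation pass to the adjoints: it allows to
    test the equality against the vectors [W x] only. *)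
Lemma unitary_intertwines_adjoint (R : realType) (H H' : hilbert R)
    (W : {linear H -> H'}) (A B : H -> H) (A' B' : H' -> H') :
  (forall y, exists x, W x = y) ->
  (forall x y, inner (W x) (W y) = inner x y) ->
  (forall h, W (A h) = A' (W h)) ->
  (forall x y, inner (A x) y = inner x (B y)) ->
  (forall x y, inner (A' x) y = inner x (B' y)) ->
  forall h, W (B h) = B' (W h).
Proof.
move=> Wsurj Wiso WA AB AB' h; apply: inner_ext => z; have [x <-] := Wsurj z.
by rewrite Wiso -AB -Wiso WA AB'.
Qed.

(** * Partial isometries permuting the basis vectors *)

Section partial_shift.
Context (R : realType) (I : choiceType).
Local Notation H := (l2 R I).

Record pinj := PInj {
  pinj_to : I -> option I;
  pinj_of : I -> option I;
  pinjP : partial_inverse pinj_to pinj_of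
}.
Implicit Types (s : pinj) (f g : H).

Definition pinj_inv s := PInj (partial_inverse_sym (@pinjP s)).

Let shift_fun s f : I -> R[i]^o := fun b => oapp f 0 (pinj_of s b).

Let sqmod_shift s f b :
  sqmod (shift_fun s f b) = oapp (fun a => sqmod (f a)) 0 (pinj_of s b).
Proof. by rewrite /shift_fun; case: (pinj_of s b) => //=; rewrite sqmod0. Qed.

Let shift_fun_le s f (A : {fset I}) :
  \sum_(b <- A) sqmod (shift_fun s f b) <= l2_sqnorm f.
Proof.
under eq_bigr do rewrite sqmod_shift.
have := sum_partial_inverse (fun a _ => sqmod (f a)) A (@pinjP s) => /= ->.
apply: le_trans (sum_le_usum _ (l2_summable f) (fun i => sqmod_ge0 _)).
by apply: ler_sum => a _; case: (pinj_to s a) => //=; exact: sqmod_ge0.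
Qed.

Let shift_funP s f : shift_fun s f \in @l2_pred R I.
Proof.
apply/asboolP; apply: ge0_abs_summable (shift_fun_le s f) => b.
exact: sqmod_ge0.
Qed.

(** The partial isometry that sends the basis vector of [a] to that of
    [pinj_to s a], or to 0 when this is [None]; coordinates of the image are
    read off through the inverse [pinj_of s]. *)
Definition shift s f : H := L2 (shift_funP s f).

Lemma shiftE s f b : shift s f b = oapp f 0 (pinj_of s b).
Proof. by []. Qed.

Lemma shift_is_linear s : linear (shift s).
Proof.
move=> c f g; apply: l2_ext => b; rewrite l2D l2Z !shiftE.
by case: (pinj_of s b) => //=; rewrite mulr0 addr0.
Qed.

HB.instance Definition _ s :=
  GRing.isLinear.Build R[i] H H *:%R (shift s) (shift_is_linear s).

Lemma shift_bounded s : exists M : R[i], forall f, `|shift s f| <= M * `|f|.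
Proof.
exists 1 => f; rewrite mul1r !l2_normE lecR ler_wsqrtr//.
by apply: usum_le => [|A]; [exact: l2_summable|exact: shift_fun_le].
Qed.

Definition shift_op s : bounded_op (l2_hilbert R I) :=
  @BoundedOp R (l2_hilbert R I) (shift s) (shift_bounded s).

(** Both inner products are sums over the pairs [a], [b] with
    [pinj_to s a = Some b]: one is indexed by [b], the other by [a]. *)
Lemma inner_shift s f g :
  l2_inner (shift s f) g = l2_inner f (shift (pinj_inv s) g).
Proof.
pose F a b := (f a : R[i]) * (g b : R[i])^*.
have FE a : oapp (F a) 0 (pinj_to s a) =
    (f a : R[i]) * (shift (pinj_inv s) g a : R[i])^*.
  by rewrite shiftE /=; case: (pinj_to s a) => //=; rewrite rmorph0 mulr0.
have FS : csummable (fun a => oapp (F a) 0 (pinj_to s a)).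
  by under [X in csummable X]funext do rewrite FE; apply: csummable_mul_conj;
    exact: l2_summable.
transitivity (csum (fun b => oapp (F^~ b) 0 (pinj_of s b))).
  apply: eq_csum => b; rewrite shiftE.
  by case: (pinj_of s b) => //=; rewrite mul0r.
by rewrite (csum_partial_inverse (@pinjP s) FS); apply: eq_csum => a; rewrite FE.
Qed.

Lemma adjoint_shift s : adjoint (shift_op s) = shift (pinj_inv s).
Proof. by apply: adjoint_eq => f g; apply: inner_shift. Qed.

Let restrict_inverse (P : pred I) :
  partial_inverse (fun a => if P a then Some a else None)
    (fun a => if P a then Some a else None).
Proof.
by move=> a b; split; [case: ifP => // Pa|case: ifP => // Pb] => -[<-];
  rewrite ?Pa ?Pb.
Qed.

Definition restrict (P : pred I) : H -> H := shift (PInj (restrict_inverse P)).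

Lemma restrictE P f a : restrict P f a = if P a then f a else 0.
Proof. by rewrite shiftE /=; case: ifP. Qed.

Lemma eq_restrict P Q : P =1 Q -> restrict P = restrict Q.
Proof.
by move=> PQ; apply/funext => f; apply: l2_ext => a; rewrite !restrictE PQ.
Qed.

Lemma restrictT : restrict predT = id.
Proof. by apply/funext => f; apply: l2_ext => a; rewrite restrictE. Qed.

(** A projection is positive, being idempotent and self-adjoint. *)
Lemma restrict_positive P : positive_op (restrict P : l2_hilbert R I -> _).
Proof.
move=> f; have -> : restrict P f = restrict P (restrict P f).
  by apply: l2_ext => a; rewrite !restrictE; case: ifP.
rewrite [X in 0 <= X](inner_shift _ (restrict P f) f).
have -> : shift (pinj_inv (PInj (restrict_inverse P))) f = restrict P f.
  exact: l2_ext.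
by rewrite l2_innerN exprn_ge0.
Qed.

Lemma l2_sqnorm_restrictC (P : pred I) f :
  l2_sqnorm (restrict P f) + l2_sqnorm (restrict (predC P) f) = l2_sqnorm f.
Proof.
rewrite /l2_sqnorm -usumD; [|exact: l2_summable..].
apply: eq_usum => a; rewrite !restrictE /=.
by case: (P a) => /=; rewrite sqmod0 ?addr0 ?add0r.
Qed.

(** Up to an error [e ^+ 2], the squared norm of [f] is carried by a finite set
    [A], and [P m] avoids [A] for large [m]. *)
Lemma restrict_cvg0 (P : nat -> pred I) f :
  (forall a, \forall m \near \oo, ~~ P m a) ->
  restrict (P m) f @[m --> \oo] --> (0 : H).
Proof.
move=> Pout; apply/cvgr0Pnorm_lt => e'; case: e' => e b.
rewrite ltcE /= => /andP[/eqP -> e0].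
have [A ltA] : exists A : {fset I},
    l2_sqnorm f - e ^+ 2 < \sum_(a <- A) sqmod (f a).
  apply/not_existsP => noA.
  have : l2_sqnorm f <= l2_sqnorm f - e ^+ 2.
    apply: usum_le => [|A]; first exact: l2_summable.
    by rewrite leNgt; apply/negP.
  by rewrite lerBrDr gerDl leNgt exprn_gt0.
have allA : \forall m \near \oo, all (fun a => ~~ P m a) A.
  elim: {ltA}(A : seq I) => [|a r IH] /=; first exact: nearW.
  by near=> m; apply/andP; split; near: m.
near=> m; rewrite l2_norm_lt//.
have /allP outA : all (fun a => ~~ P m a) A by near: m.
rewrite -(ltrD2r (l2_sqnorm (restrict (predC (P m)) f))) l2_sqnorm_restrictC.
rewrite -ltrBlDl; apply: lt_le_trans ltA _.
apply: le_trans (sum_le_usum A (l2_summable _) (fun i => sqmod_ge0 _)).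
by rewrite big_seq [leRHS]big_seq; apply: ler_sum => a /outA Pa;
  rewrite restrictE /= Pa.
Unshelve. all: by end_near. Qed.

Definition delta_fun (a : I) : I -> R[i]^o := fun b => (b == a)%:R.

Let delta_funP a : delta_fun a \in @l2_pred R I.
Proof.
apply/asboolP; apply: (@ge0_abs_summable _ _ _ 1) => [b|A].
  exact: sqmod_ge0.
have [aA|aA] := boolP (a \in A).
  rewrite (big_fsetD1 a)//= /delta_fun eqxx big_seq big1 ?addr0 => [|b].
    by rewrite /sqmod /= expr1n expr0n addr0.
  by rewrite !inE => /andP[/negbTE -> _]; rewrite sqmod0.
rewrite big_seq big1// => b bA; rewrite /delta_fun.
by case: eqP bA aA => [-> ->|]//; rewrite sqmod0.
Qed.

Definition delta a : H := L2 (delta_funP a).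

Lemma deltaE a b : delta a b = (b == a)%:R.
Proof. by []. Qed.

Lemma delta_neq0 a : delta a != 0.
Proof.
apply/eqP => /(congr1 (fun f : H => f a)); rewrite deltaE eqxx => /eqP.
by rewrite oner_eq0.
Qed.

Lemma shift_delta s a : shift s (delta a) = oapp delta 0 (pinj_to s a).
Proof.
apply: l2_ext => b; rewrite shiftE.
have -> : oapp (delta a) 0 (pinj_of s b) = (pinj_of s b == Some a)%:R.
  by case: (pinj_of s b).
have -> : oapp delta 0 (pinj_to s a) b = (pinj_to s a == Some b)%:R.
  by case: (pinj_to s a) => [a'|] //=; rewrite /delta_fun eq_sym.
suff -> : (pinj_of s b == Some a) = (pinj_to s a == Some b) by [].
by apply/eqP/eqP => /(pinjP s).
Qed.

Lemma lin_indep_delta (d : nat) (nu : 'I_d -> I) : injective nu ->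
  @lin_indep R (l2_hilbert R I) d (delta \o nu).
Proof.
move=> inj c c0 i.
have {}c0 : \sum_(j < d) c j *: (delta (nu j) : H) = 0 by [].
have := congr1 (fun f : H => f (nu i)) c0.
rewrite l2_sum (bigD1 i)// l2Z deltaE eqxx mulr1 big1 => [|j ji].
  by rewrite /= addr0.
by rewrite l2Z deltaE (inj_eq inj) eq_sym (negbTE ji) mulr0.
Qed.

End partial_shift.

(** * The operator tuple of a tree of words *)

(** Words grow by prepending letters, as in the left creation operators, so the
    parent of a nonempty word is obtained by removing its first letter. *)
Record tree (m : nat) := Tree {
  in_tree :> pred (seq 'I_m);
  tree_nil : in_tree [::];
  tree_cons : forall j w, in_tree (j :: w) -> in_tree w
}.

Definition level_card (m : nat) (T : tree m) (l : nat) : nat :=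
  #|[pred w : l.-tuple 'I_m | T w]|.

Section tree_tuple.
Context (R : realType) (k : nat) (n : 'I_k -> nat) (i0 : 'I_k) (T : tree (n i0)).

Definition words := forall i : 'I_k, seq 'I_(n i).

Definition no_letters : words := fun=> [::].

Definition node := {w : words | T (w i0)}.
Implicit Types (w : words) (a b : node).

Definition push_word i (j : 'I_(n i)) w : words := eqtype.dfwith w (j :: w i).

Definition push i j a : option node := insub (@push_word i j (val a)).

Definition pop i (j : 'I_(n i)) b : option node :=
  if val b i is j' :: u then
    if j' == j then (insub (eqtype.dfwith (val b) u : words) : option node)
    else None
  else None.

Definition child i (j : 'I_(n i)) a b :=
  val b i = j :: val a i /\ forall l, l != i -> val b l = val a l.

Lemma dfwith_eq w w' i (u : seq 'I_(n i)) :
  w' i = u -> (forall l, l != i -> w' l = w l) -> w' = eqtype.dfwith w u.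
Proof.
move=> w'i w'l; apply: functional_extensionality_dep => l.
have [li|il] := eqVneq i l; last by rewrite dfwith_out // w'l // eq_sym.
by rewrite -li dfwith_in.
Qed.

(** [push j] and [pop j] both compute the relation [child], in the two
    directions; hence they are partial inverses of each other. *)
Lemma pushP i j a b : push j a = Some b <-> @child i j a b.
Proof.
rewrite /push; split=> [|[bi bl]].
  case: insubP => // b' _ b'E [<-]; rewrite /child b'E /push_word dfwith_in.
  by split=> // l li; rewrite dfwith_out // eq_sym.
have <- : val b = push_word j (val a) by apply: dfwith_eq.
by rewrite valK.
Qed.

Lemma popP i j a b : pop j b = Some a <-> @child i j a b.
Proof.
rewrite /pop /child; case E: (val b i) => [|j' u]; first by split=> // -[].
have [->|jj'] := eqVneq j' j; last by split=> // -[[/eqP]]; rewrite (negbTE jj').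
split=> [|[[ua] bl]].
  case: insubP => // a' _ a'E [<-]; rewrite a'E dfwith_in.
  by split=> // l li; rewrite dfwith_out // eq_sym.
have <- : val a = eqtype.dfwith (val b) u by apply: dfwith_eq => // l /bl.
by rewrite valK.
Qed.

Lemma push_pop_inverse i (j : 'I_(n i)) : partial_inverse (push j) (pop j).
Proof. by move=> a b; split=> [/pushP /popP|/popP /pushP]. Qed.

(** Here the closure of the tree under removing the first letter is used: the
    span of the nodes is invariant under the adjoints of the creation
    operators. *)
Lemma child_exists b i j u : val b i = j :: u ->
  exists2 a, @child i j a b & val a i = u.
Proof.
move=> bi; pose w : words := eqtype.dfwith (val b) u.
have Tw : T (w i0).
  rewrite /w; have [ii0|ii0] := eqVneq i i0; last first.
    by rewrite dfwith_out //; exact: (valP b).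
  subst i; rewrite dfwith_in; apply: (@tree_cons _ T j).
  by rewrite -bi; exact: (valP b).
exists (exist _ w Tw); last by rewrite /= /w dfwith_in.
split; rewrite /= /w ?dfwith_in// => l li.
by rewrite dfwith_out // eq_sym.
Qed.

Local Notation H := (l2_hilbert R node).

Definition word_pinj i (j : 'I_(n i)) := PInj (push_pop_inverse j).

Definition tree_tuple : op_tuple n H := fun i j => shift_op R (word_pinj j).

Lemma tree_tupleE i j (f : H) b :
  (tree_tuple (i := i) j f : l2 R node) b = oapp (f : l2 R node) 0 (pop j b).
Proof. by []. Qed.

(* Removing letters in two coordinates: the intermediate tuple for the other
   order of removal is again a node. *)
Let pop_pop_sub s t (j : 'I_(n s)) (l : 'I_(n t)) b c : s != t ->
  obind (pop l) (pop j b) = Some c -> obind (pop j) (pop l b) = Some c.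
Proof.
move=> st; case Ea: (pop j b) => [a|] //= /popP[at_ al].
have /popP[bs bl] := Ea.
have [|a' ba' a't] := @child_exists b t l (val c t).
  by rewrite bl 1?eq_sym.
have /popP -> := ba'; rewrite /=; apply/popP.
have [_ ba'l] := ba'; split; first by rewrite -ba'l // bs al.
move=> m ms; have [->|mt] := eqVneq m t; first by [].
by rewrite -ba'l // bl // al.
Qed.

Let pop_pop s t (j : 'I_(n s)) (l : 'I_(n t)) b : s != t ->
  obind (pop l) (pop j b) = obind (pop j) (pop l b).
Proof.
move=> st; case E: (obind (pop l) (pop j b)) => [c|].
  by rewrite (pop_pop_sub st E).
case E': (obind (pop j) (pop l b)) => [c|] //.
by rewrite (@pop_pop_sub t s l j b c) ?E // eq_sym in E.
Qed.

Lemma tree_tuple_commute : commuting_tuple tree_tuple.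
Proof.
move=> s t st j l f; apply: l2_ext => b.
transitivity (oapp (f : l2 R node) 0 (obind (pop l) (pop j b))).
  by rewrite [LHS]tree_tupleE; case: (pop j b).
by rewrite pop_pop // [RHS]tree_tupleE; case: (pop l b).
Qed.

(** The first letter [j] of [val b i] is the only one that [pop] can remove. *)
Definition after_pop i (P : pred node) b :=
  if val b i is j :: _ then oapp P false (pop (i := i) j b) else false.

Lemma after_pop_child i j (P : pred node) a b : @child i j a b ->
  after_pop i P b = P a.
Proof. by rewrite /after_pop => ba; have [-> _] := ba; rewrite (popP j a b).2. Qed.

Lemma after_pop_nil i (P : pred node) b : val b i = [::] ->
  after_pop i P b = false.
Proof. by rewrite /after_pop => ->. Qed.

(** In the sum defining [Phi], only the term of the first letter of [val b i]
    contributes to the coordinate [b], and it removes this letter and puts it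
    back. *)
Lemma Phi_restrict i (P : pred node) :
  Phi (tree_tuple (i := i)) (restrict P : H -> H) = restrict (after_pop i P).
Proof.
apply/funext => f; apply: l2_ext => b.
rewrite /Phi [LHS](l2_sum (I := node)) restrictE.
have summandE j :
    (tree_tuple j (restrict P (adjoint (tree_tuple j) f)) : l2 R node) b =
    oapp (fun a => if P a then (f : l2 R node) b else 0) 0 (pop (i := i) j b).
  rewrite /tree_tuple adjoint_shift [LHS]tree_tupleE.
  case ba: (pop j b) => [a|] //.
  rewrite [oapp _ _ _]restrictE shiftE [pinj_of _ _](pushP j a b).2 //.
  by apply/popP.
under eq_bigr do rewrite summandE.
case bi: (val b i) => [|j u].
  rewrite after_pop_nil // big1// => j _.
  by case ba: (pop j b) => [a|] //=; have /popP[] := ba; rewrite bi.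
have [a ba _] := child_exists bi.
rewrite (after_pop_child P ba) (bigD1 j) //= (popP j a b).2 //=.
rewrite big1 ?addr0 // => l lj.
case ba': (pop l b) => [a'|] //=; have /popP[] := ba'; rewrite bi => -[jl].
by rewrite jl eqxx in lj.
Qed.

Lemma iter_Phi i m : iter m (Phi (tree_tuple (i := i))) id =
  restrict (fun b => (m <= size (val b i))%N) :> (H -> H).
Proof.
elim: m => [|m IH].
  by rewrite -[LHS]restrictT; apply: eq_restrict => b; rewrite leq0n.
rewrite iterS IH Phi_restrict; apply: eq_restrict => b.
case bi: (val b i) => [|j u]; first by rewrite after_pop_nil.
have [a ba ai] := child_exists bi.
by rewrite (after_pop_child _ ba) ai.
Qed.

Lemma tree_tuple_pure : pure_tuple tree_tuple.
Proof.
move=> i f; under [X in X @ \oo]funext do rewrite iter_Phi.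
apply: (restrict_cvg0 (P := fun m b => (m <= size (val b i))%N)) => b.
by exists (size (val b i)).+1 => // m /=; rewrite ltnNge.
Qed.

Definition empty_on (s : seq 'I_k) b := all (fun i => val b i == [::]) s.

(** When [P] does not depend on the coordinate [i], the projection
    [Phi (restrict P)] keeps the nodes of [P] with a nonempty word at [i], and
    subtracting it leaves those with an empty word there. *)
Lemma Delta_restrict (p : 'I_k -> bool) : Delta tree_tuple p id =
  restrict (empty_on [seq i <- index_enum 'I_k | p i]) :> (H -> H).
Proof.
rewrite /Delta; elim: (index_enum _) (index_enum_uniq 'I_k) => [_|i r IH] /=.
  by rewrite big_nil -[LHS]restrictT.
move=> /andP[ir ur]; rewrite big_cons /= {}IH //.
case: (p i) => //=; rewrite Phi_restrict.
apply/funext => f; apply: l2_ext => b.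
rewrite [LHS](l2B (I := node)) !restrictE.
rewrite [empty_on (_ :: _) b]/(_ && empty_on _ b).
case bi: (val b i) => [|j u].
  by rewrite after_pop_nil // subr0.
have [a ba _] := child_exists bi.
rewrite (after_pop_child _ ba) (_ : empty_on _ a = empty_on [seq i <- r | p i] b).
  by case: ifP => _; rewrite subrr.
apply: eq_in_all => l; rewrite mem_filter => /andP[_ lr].
have [_ ->] := ba => //; apply: contraNneq ir => <-.
exact: lr.
Qed.

Lemma tree_tuple_polyball : in_polyball tree_tuple.
Proof.
split; first exact: tree_tuple_commute.
by move=> p; rewrite Delta_restrict; apply: restrict_positive.
Qed.

(** * The defect and the action on the empty tuple *)

Definition root : node :=
  exist (fun w : words => T (w i0)) no_letters (tree_nil T).

(** Extending the basis vectors by 0 outside the tree gives one formula for the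
    action of letters and words, whether or not the result stays in the
    tree. *)
Definition word_delta w : H := oapp (@delta R node) 0 (insub w : option node).

Lemma word_delta_node a : word_delta (val a) = delta R a.
Proof. by rewrite /word_delta valK. Qed.

Lemma word_delta_out w : ~~ T (w i0) -> word_delta w = 0.
Proof. by move=> wT; rewrite /word_delta insubN. Qed.

Lemma word_delta_in w (wT : T (w i0)) :
  word_delta w = delta R (exist (fun w => is_true (T (w i0))) w wT).
Proof. by rewrite -word_delta_node. Qed.

Lemma word_delta_eq0 w : word_delta w = 0 <-> ~~ T (w i0).
Proof.
split; last exact: word_delta_out.
case: (boolP (T (w i0))) => // wT.
by rewrite word_delta_in => /eqP; rewrite (negbTE (delta_neq0 _ _)).
Qed.

Lemma tree_tuple_word_delta i j w :
  tree_tuple (i := i) j (word_delta w) = word_delta (push_word j w).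
Proof.
have [wT|wT] := boolP (T (w i0)).
  by rewrite word_delta_in [LHS]shift_delta.
rewrite !word_delta_out ?linear0 //; apply: contra wT.
rewrite /push_word; have [ii0|ii0] := eqVneq i i0; last by rewrite dfwith_out.
by subst i; rewrite dfwith_in; apply: tree_cons.
Qed.

Lemma word_op_word_delta i alpha c w :
  word_op (tree_tuple (i := i)) alpha (c *: word_delta w) =
  c *: word_delta (eqtype.dfwith w (alpha ++ w i)).
Proof.
elim: alpha => [|j alpha IH].
  by congr (_ *: word_delta _); apply: dfwith_eq.
rewrite [LHS]/= [X in tree_tuple j X]IH linearZ /= tree_tuple_word_delta.
congr (_ *: word_delta _); rewrite /push_word; apply: dfwith_eq.
  by rewrite !dfwith_in.
by move=> l li; rewrite !dfwith_out // eq_sym.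
Qed.

Lemma words_op_root (alpha : words) c :
  (\big[(fun F G => F \o G)/id]_(i < k) word_op (tree_tuple (i := i)) (alpha i))
    (c *: delta R root : H) = c *: word_delta alpha.
Proof.
rewrite -word_delta_node.
rewrite (_ : alpha =
  fun l => if l \in index_enum 'I_k then alpha l else [::]); last first.
  by apply: functional_extensionality_dep => l; rewrite mem_index_enum.
under eq_bigr do rewrite mem_index_enum.
elim: (index_enum _) (index_enum_uniq 'I_k) => [_|i r IH].
  by rewrite big_nil.
move=> /andP[ir ur]; rewrite big_cons [LHS]/= [X in word_op _ _ X](IH ur).
rewrite word_op_word_delta (negbTE ir) cats0; congr (_ *: word_delta _).
apply/esym/dfwith_eq => [|l li]; first by rewrite mem_head.
by rewrite inE (negbTE li).
Qed.

Lemma defectE (f : H) :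
  defect tree_tuple f = (f : l2 R node) root *: (delta R root : H).
Proof.
rewrite /defect Delta_restrict; apply: l2_ext => b.
rewrite restrictE [RHS](l2Z (I := node)) deltaE.
rewrite (_ : empty_on _ b = (b == root)).
  by have [->|] := eqVneq b root; rewrite ?mulr1 ?mulr0.
apply/allP/eqP => [b0|-> //].
apply/val_inj/functional_extensionality_dep => l; apply/eqP/b0.
by rewrite mem_filter mem_index_enum.
Qed.

Lemma range_defect : has_dim (range (defect tree_tuple)) 1.
Proof.
exists (fun=> delta R root : H); split.
  by apply: (lin_indep_delta (nu := fun=> root)) => i j _; rewrite !ord1.
apply/seteqP; split=> [_ [f _ <-]|v].
  exists 1%N, (fun=> (f : l2 R node) root), (fun=> delta R root).
  by split; [move=> i; exists ord0|rewrite big_ord1 defectE].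
move=> /lin_span_rangeP[a ->]; exists (a 0 *: (delta R root : H)) => //.
by rewrite defectE big_ord1 [X in X *: _](l2Z (I := node)) deltaE eqxx mulr1.
Qed.

Lemma rank_tree_tuple : rank tree_tuple = 1%N.
Proof. exact: dim_eq range_defect. Qed.

Lemma finite_rank_tree_tuple : finite_rank tree_tuple.
Proof. by exists 1%N; exact: range_defect. Qed.

(** * The dimension of the spaces M_q *)

Section word_boxes.
Context (m : 'I_k -> nat).

Definition short_word i := {l : 'I_(m i).+1 & l.-tuple 'I_(n i)}.

Definition letters i (x : short_word i) : seq 'I_(n i) := tagged x.

Lemma letters_inj i : injective (@letters i).
Proof.
move=> [l x] [l' x']; rewrite /letters /= => xx'.
have ll' : l = l' by apply/val_inj; rewrite /= -(size_tuple x) xx' size_tuple.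
by subst l'; congr (existT _ _ _); apply/val_inj.
Qed.

Lemma size_letters i (x : short_word i) : (size (letters x) <= m i)%N.
Proof. by case: x => l x; rewrite size_tuple -ltnS. Qed.

Lemma letters_surj i (w : seq 'I_(n i)) : (size w <= m i)%N ->
  exists x : short_word i, letters x = w.
Proof.
by rewrite -ltnS => lt; exists (existT _ (Ordinal lt) (in_tuple w)).
Qed.

(** The condition is put on every coordinate to fit the format of [family]: for
    [i] different from [i0] it concerns the empty word, and holds. *)
Definition word_box : {pred {dffun forall i, short_word i}} :=
  family (fun i (x : short_word i) =>
    T (eqtype.dfwith no_letters (letters x) i0)).

Definition box_words (x : {dffun forall i, short_word i}) : words :=
  fun i => letters (x i).

Lemma word_boxP x : reflect (T (box_words x i0)) (x \in word_box).
Proof.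
apply: (iffP familyP) => [/(_ i0)|xT i]; first by rewrite unfold_in dfwith_in.
rewrite unfold_in; have [ii0|ii0] := eqVneq i i0.
  by subst i; rewrite dfwith_in.
by rewrite dfwith_out //; exact: tree_nil.
Qed.

Definition box_node (a : 'I_#|word_box|) : node :=
  exist (fun w : words => T (w i0)) (box_words (enum_val a))
    (word_boxP _ (enum_valP a)).

Lemma box_node_inj : injective box_node.
Proof.
move=> a a' /(congr1 val) /= aa'; apply/enum_val_inj/ffunP => i.
by apply: letters_inj; rewrite -[LHS]/(box_words _ i) aa'.
Qed.

Lemma box_node_surj (b : node) : (forall i, size (val b i) <= m i)%N ->
  exists a : 'I_#|word_box|, box_node a = b.
Proof.
move=> bm; pose x : {dffun forall i, short_word i} :=
  [ffun i => projT1 (cid (letters_surj (bm i)))].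
have xb : box_words x = val b.
  apply: functional_extensionality_dep => i; rewrite /box_words ffunE.
  by case: (cid _).
have xbox : x \in word_box by apply/word_boxP; rewrite xb; exact: (valP b).
exists (enum_rank_in xbox x); apply: val_inj.
by rewrite /= enum_rankK_in.
Qed.

Lemma M_space_dim : has_dim (M_space tree_tuple m) #|word_box|.
Proof.
exists ((@delta R node) \o box_node); split.
  exact: lin_indep_delta box_node_inj.
apply: lin_span_eq => v.
  move=> [alpha [h [am ->]]]; rewrite defectE words_op_root.
  have [aT|aT] := boolP (T (alpha i0)); last first.
    by rewrite word_delta_out // scaler0; exact: lin_span0.
  rewrite word_delta_in; set b := exist _ _ _.
  have [a <-] := @box_node_surj b am.
  rewrite -[_ *: _]addr0; apply: lin_spanP; last exact: lin_span0.
  by apply: lin_span_sub; exists a.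
move=> [a _ <-]; apply: lin_span_sub.
exists (val (box_node a)), (delta R root); split.
  by move=> i; exact: size_letters.
by rewrite defectE words_op_root deltaE eqxx scale1r word_delta_node.
Qed.

Definition tree_card : nat := #|[pred x : short_word i0 | T (letters x)]|.

Lemma card_word_box : #|word_box| =
  (tree_card * \prod_(i < k | i != i0) \sum_(l < (m i).+1) n i ^ l)%N.
Proof.
rewrite card_family foldrE big_map big_enum /= (bigD1 i0) //=; congr (_ * _)%N.
  by apply: eq_card => x; rewrite !inE unfold_in /= dfwith_in.
apply: eq_bigr => i ii0.
rewrite (eq_card (B := predT)) => [|x]; last first.
  by rewrite !inE unfold_in /= dfwith_out //; exact: tree_nil.
rewrite card_tagged sumnE big_map big_enum /=; apply: eq_bigr => l _.
by rewrite card_tuple card_ord.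
Qed.

End word_boxes.

(** * Euler characteristic and unitary equivalence *)

Lemma tree_cardE m : tree_card m = (\sum_(l < (m i0).+1) level_card T l)%N.
Proof.
rewrite /tree_card -sum1_card.
transitivity (\sum_(l < (m i0).+1) \sum_(w : l.-tuple 'I_(n i0) | T w) 1)%N.
  by rewrite (sig_big_dep (fun=> true)
    (fun (l : 'I_(m i0).+1) (w : l.-tuple 'I_(n i0)) => T w)).
by apply: eq_bigr => l _; rewrite sum1_card.
Qed.

Lemma increasing_cofinal_cvg (q : nat -> 'I_k -> nat) i :
  increasing_cofinal q -> q m i @[m --> \oo] --> \oo.
Proof.
move=> [qS qoo] A [N _ NA]; have [m qm] := qoo (fun=> N).
exists m => // m' /= /subnKC <-; apply: NA; rewrite /=.
elim: (m' - m)%N => [|d IH]; first by rewrite addn0.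
by rewrite addnS; apply: leq_trans IH (qS _ _).
Qed.

(** The coordinates other than [i0] contribute the same factor to the dimension
    and to the denominator. *)
Lemma tree_tuple_euler (t : R) :
  (\sum_(l < N.+1) level_card T l)%N%:R / (\sum_(l < N.+1) n i0 ^ l)%N%:R
    @[N --> \oo] --> t ->
  has_euler_characteristic tree_tuple t.
Proof.
move=> ct; split=> [|q q_cof]; first exact: finite_rank_tree_tuple.
have := cvg_comp _ _ (@increasing_cofinal_cvg q i0 q_cof) ct.
apply: cvg_trans; apply: near_eq_cvg; apply: nearW => m /=.
rewrite (dim_eq (M_space_dim (q m))) card_word_box tree_cardE.
rewrite [X in _ = _ / X%:R](bigD1 i0) //= !natrM -mulf_div divff ?mulr1 //.
rewrite pnatr_eq0 -lt0n prodn_gt0 // => i.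
by rewrite big_ord_recl expn0.
Qed.

(** Every node other than the root is the child of some node, so that its
    coordinate is recovered from some adjoint. *)
Lemma adjoint_ker_root (f : H) :
  (forall i (j : 'I_(n i)), adjoint (tree_tuple j) f = 0) ->
  f = (f : l2 R node) root *: (delta R root : H).
Proof.
move=> f0; apply: l2_ext => b; rewrite [RHS](l2Z (I := node)) deltaE.
have [->|b_root] := eqVneq b root; first by rewrite mulr1.
rewrite mulr0; have [i bi] : exists i, val b i != [::].
  apply/existsP; apply: contraNT b_root; rewrite negb_exists => /forallP b0.
  apply/eqP/val_inj/functional_extensionality_dep => i.
  by apply/eqP; rewrite -[_ == _]negbK.
case bij: (val b i) bi => [//|j u] _; have [a ba _] := child_exists bij.
have := congr1 (fun g : l2 R node => g a) (f0 i j).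
by rewrite /tree_tuple adjoint_shift shiftE [pinj_of _ _](pushP j a b).2.
Qed.

End tree_tuple.

Section unitary_invariant.
Context (R : realType) (k : nat) (n : 'I_k -> nat) (i0 : 'I_k).
Context (T T' : tree (n i0)).

Lemma tree_tuple_unitary_invariant :
  unitarily_equivalent (tree_tuple R T) (tree_tuple R T') -> T =1 T'.
Proof.
move=> [W [Wsurj Wiso WX]] alpha.
pose e : l2_hilbert R (node T) := delta R (root T).
pose e' : l2_hilbert R (node T') := delta R (root T').
have We : exists c, W e = c *: e'.
  exists ((W e : l2 R (node T')) (root T')); apply: adjoint_ker_root => i j.
  have inter := unitary_intertwines_adjoint Wsurj Wiso (WX i j)
    (@inner_shift _ _ _) (@inner_shift _ _ _).
  rewrite /tree_tuple adjoint_shift -inter.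
  rewrite (_ : shift _ e = 0) ?linear0 // /e shift_delta.
  by rewrite [pinj_to _ _](_ : _ = None).
have [c Wec] := We.
have W0 x : W x = 0 -> x = 0.
  move=> Wx; apply/eqP; rewrite -normr_eq0 -sqrf_eq0 -innerE -Wiso Wx.
  by rewrite linear0l.
have c_neq0 : c != 0.
  apply/eqP => c0; have := W0 e; rewrite Wec c0 scale0r => /(_ erefl)/eqP.
  by rewrite (negbTE (delta_neq0 _ _)).
pose w : words n := eqtype.dfwith (@no_letters _ n) alpha.
have wE : w i0 = alpha by rewrite /w dfwith_in.
have Wword beta h : W (word_op (tree_tuple R T (i := i0)) beta h) =
    word_op (tree_tuple R T' (i := i0)) beta (W h).
  by elim: beta => [//|j beta IH] /=; rewrite WX IH.
have wordE (S : tree (n i0)) a : word_op (tree_tuple R S (i := i0)) alpha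
    (a *: delta R (root S)) = a *: word_delta R S w.
  rewrite -(word_delta_node R (root S)) word_op_word_delta.
  by congr (_ *: word_delta _ _ _); rewrite cats0.
have Ww : W (word_delta R T w) = c *: word_delta R T' w.
  have := wordE T 1; rewrite !scale1r => <-.
  by rewrite Wword -/e Wec wordE.
rewrite -wE; apply: negb_inj; apply/idP/idP => /(word_delta_eq0 R) w0.
  apply/(word_delta_eq0 R); apply/eqP; move: Ww; rewrite w0 linear0 => /esym/eqP.
  by rewrite scaler_eq0 (negbTE c_neq0).
by apply/(word_delta_eq0 R); apply: W0; rewrite Ww w0 scaler0.
Qed.

End unitary_invariant.

(** * Trees of prescribed density *)

Section interval_trees.
Context (R : realType) (n : nat).

(** The last letter is the most significant digit, so that prepending a letter
    refines the n-adic interval of length [n ^- size w] with left end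
    [base_value w / n ^ size w]. *)
Fixpoint base_value (w : seq 'I_n) : nat :=
  if w is j :: w' then base_value w' * n + j else 0.

Lemma base_value_lt w : (base_value w < n ^ size w)%N.
Proof.
elim: w => [//|j w IH] /=; rewrite expnSr.
apply: (@leq_trans ((base_value w).+1 * n)); last by rewrite leq_mul2r IH orbT.
by rewrite mulSn addnC ltn_add2r.
Qed.

Lemma base_value_inj w w' :
  size w = size w' -> base_value w = base_value w' -> w = w'.
Proof.
elim: w w' => [|j w IH] [|j' w'] //= [sz] vv'.
have n_gt0 : (0 < n)%N by apply: leq_ltn_trans (ltn_ord j).
have jj' : j = j'.
  apply/val_inj; have := congr1 (modn^~ n) vv'.
  by rewrite !modnMDl !modn_small.
rewrite jj' (IH w') //; have := congr1 (divn^~ n) vv'.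
by rewrite !divnMDl // !divn_small // !addn0.
Qed.

Lemma card_base_value (l u : nat) : (u <= n ^ l)%N ->
  #|[pred w : l.-tuple 'I_n | (base_value w < u)%N]| = u.
Proof.
move=> ul; have lt (w : l.-tuple 'I_n) : (base_value w < n ^ l)%N.
  by have := base_value_lt w; rewrite size_tuple.
pose f w := Ordinal (lt w).
have f_inj : injective f.
  move=> w w' [] /base_value_inj ww'.
  by apply/val_inj/ww'; rewrite !size_tuple.
rewrite -(fintype.card_image f_inj).
rewrite (eq_card (B := [pred a : 'I_(n ^ l) | (a < u)%N])).
  by rewrite -sum1_card (big_ord_narrow ul) /= big_const_ord iter_addn_0 mul1n.
move=> a; have /codomP[w ->] : a \in codom f.
  by apply: (inj_card_onto f_inj); rewrite card_tuple !card_ord.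
by rewrite fintype.mem_image.
Qed.

Lemma card_base_value_le (l u : nat) :
  (#|[pred w : l.-tuple 'I_n | (base_value w < u)%N]| <= u)%N.
Proof.
have [ul|/ltnW ul] := leqP u (n ^ l); first by rewrite card_base_value.
by apply: leq_trans (max_card _) _; rewrite card_tuple card_ord.
Qed.

Context (s t : R) (s_ge0 : 0 <= s) (t_gt0 : 0 < t) (st_le1 : s + t <= 1).

(** The n-adic interval of [w] meets the interval from [s] to [s + t]; the
    inequalities are cleared of the denominator [n ^ size w]. *)
Definition in_interval (w : seq 'I_n) :=
  (s * (n ^ size w)%:R < (base_value w).+1%:R) &&
  ((base_value w)%:R < (s + t) * (n ^ size w)%:R).

Lemma in_interval_nil : in_interval [::].
Proof.
rewrite /in_interval /= expn0 !mulr1 ltr_wpDl // andbT.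
by apply: lt_le_trans st_le1; rewrite ltrDl.
Qed.

Lemma in_interval_cons j w : in_interval (j :: w) -> in_interval w.
Proof.
have n_gt0 : 0 < n%:R :> R by rewrite ltr0n; apply: leq_ltn_trans (ltn_ord j).
have jn : j%:R + 1 <= n%:R :> R by rewrite natr1 ler_nat.
rewrite /in_interval /= expnSr -!natr1 natrD !natrM !mulrA.
move=> /andP[lo hi]; apply/andP; split; rewrite -(ltr_pM2r n_gt0).
  by apply: lt_le_trans lo _; rewrite mulrDl mul1r -addrA lerD2l.
by apply: le_lt_trans hi; rewrite lerDl.
Qed.

Definition interval_tree : tree n := Tree in_interval_nil in_interval_cons.

(** For [x = s * n ^ l] and [y = (s + t) * n ^ l], the words of length [l] in
    the tree are those with a value between [truncn x] and [truncn y], with the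
    upper end included or not. *)
Lemma level_card_bound (l : nat) :
  `|(level_card interval_tree l)%:R - t * (n ^ l)%:R| <= 2.
Proof.
set N := (n ^ l)%N; pose x := s * N%:R; pose y := (s + t) * N%:R.
have N0 : 0 <= N%:R :> R by [].
have x0 : 0 <= x by rewrite mulr_ge0.
have xy : x <= y by rewrite ler_wpM2r // lerDl ltW.
have yN : y <= N%:R by rewrite ler_piMl.
pose p := Num.truncn x; pose u := Num.truncn y.
have /andP[px xp] : p%:R <= x < p.+1%:R by apply: truncn_itv.
have /andP[uy yu] : u%:R <= y < u.+1%:R by apply: truncn_itv; apply: le_trans xy.
have pu : (p <= u)%N by rewrite -ltnS -(ltr_nat R); lra.
have uN : (u <= N)%N by rewrite -(ler_nat R); lra.
pose below v := [pred w : l.-tuple 'I_n | (base_value w < v)%N].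
have memE (w : l.-tuple 'I_n) :
    in_interval w = (x < (base_value w).+1%:R) && ((base_value w)%:R < y).
  by rewrite /in_interval size_tuple.
pose C := [pred w : l.-tuple 'I_n | interval_tree w].
have lo : (u <= level_card interval_tree l + p)%N.
  rewrite -[leqLHS](card_base_value uN).
  rewrite -[p in leqRHS](card_base_value (leq_trans pu uN)).
  rewrite -[leqRHS](cardUI C (below p)).
  apply: leq_trans (leq_addr _ _).
  apply: subset_leq_card; apply/fintype.subsetP => w.
  rewrite !inE /= => wu; rewrite memE; case: ltnP => [_|pw]; first by rewrite orbT.
  rewrite orbF; apply/andP; split.
    by apply: lt_le_trans xp _; rewrite ler_nat ltnS.
  by apply: lt_le_trans uy; rewrite ltr_nat.
have hi : (level_card interval_tree l + p <= u.+1)%N.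
  have disj : #|[predI C & below p]| = 0%N.
    apply: eq_card0 => w; rewrite !inE /= memE -andbA; apply/and3P => -[xw _].
    by rewrite -(ler_nat R); lra.
  rewrite -[p in leqLHS](card_base_value (leq_trans pu uN)).
  rewrite -[leqLHS](cardUI C (below p)) disj addn0.
  apply: leq_trans (card_base_value_le l u.+1).
  apply: subset_leq_card; apply/fintype.subsetP => w; rewrite !inE /= memE ltnS.
  move=> /orP[/andP[_ wy]|/leq_trans]; last by move=> /(_ _ pu)/ltnW.
  by rewrite -ltnS -(ltr_nat R); lra.
move: lo hi; rewrite -!(ler_nat R) !natrD -!natr1 => lo hi.
have tE : t * N%:R = y - x by rewrite /x /y mulrDl addrAC subrr add0r.
rewrite tE ler_norml; move: xp yu; rewrite -!natr1 => xp yu.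
by apply/andP; split; lra.
Qed.

(** The errors of the levels add up to at most [2 * N.+1], whereas the number of
    all words grows at least quadratically in [N]. *)
Lemma interval_tree_density : (2 <= n)%N ->
  (\sum_(l < N.+1) level_card interval_tree l)%N%:R / (\sum_(l < N.+1) n ^ l)%N%:R
    @[N --> \oo] --> t.
Proof.
move=> n2; apply/cvgrPdist_le => e e0; near=> N.
set c := (\sum_(l < N.+1) level_card _ _)%N; set S := (\sum_(l < N.+1) n ^ l)%N.
have SN : (N.+1 * N.+2 <= 2 * S)%N.
  rewrite /S; elim: (N) => [|m IH]; first by rewrite big_ord1.
  rewrite big_ord_recr /= mulnDr.
  rewrite (_ : m.+2 * m.+3 = m.+1 * m.+2 + 2 * m.+2)%N; last by lia.
  by apply: leq_add IH _; rewrite leq_mul2l /= ltn_expl.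
have S0 : 0 < S%:R :> R by rewrite ltr0n; move: SN; case: (S) => //; rewrite muln0.
have cS : `|c%:R - t * S%:R| <= 2 * N.+1%:R.
  rewrite /c /S !natr_sum mulr_sumr -sumrB.
  apply: le_trans (ler_norm_sum _ _ _) _.
  apply: (@le_trans _ _ (\sum_(l < N.+1) 2)).
    by apply: ler_sum => l _; exact: level_card_bound.
  by rewrite sumr_const card_ord mulr_natr.
rewrite distrC (_ : c%:R / _ - t = (c%:R - t * S%:R) / S%:R); last first.
  by rewrite mulrBl mulfK // gt_eqF.
rewrite normrM normfV (ger0_norm (ltW S0)) ler_pdivrMr //.
apply: le_trans cS _.
have eN : 4 <= e * N.+2%:R.
  rewrite mulrC -ler_pdivrMr //; apply: (@le_trans _ _ N%:R).
    by near: N; apply: nbhs_infty_ger.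
  by rewrite ler_nat 2?leqW.
have : N.+1%:R * N.+2%:R <= 2 * S%:R :> R by rewrite -!natrM ler_nat.
have N1 : 0 < N.+1%:R :> R by [].
have N2 : 0 < N.+2%:R :> R by [].
by nra.
Unshelve. all: by end_near. Qed.

End interval_trees.

Lemma base_value_surj (n l v : nat) : (v < n ^ l)%N ->
  exists2 w : seq 'I_n, size w = l & base_value w = v.
Proof.
elim: l v => [|l IH] v; first by rewrite expn0 ltnS leqn0 => /eqP ->; exists [::].
rewrite expnSr => vl; have n_gt0 : (0 < n)%N.
  by rewrite lt0n; apply: contraTneq vl => ->; rewrite muln0.
have [|w wl wv] := IH (v %/ n)%N; first by rewrite ltn_divLR.
exists (Ordinal (ltn_pmod v n_gt0) :: w); rewrite /= ?wl ?wv //.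
by rewrite -divn_eq.
Qed.

(** Choose [l] so large that [(s' - s) * n ^ l > 1]. The n-adic interval of
    level [l] that contains [s] then lies to the left of [s']. *)
Lemma in_interval_lt (R : realType) (n : nat) (s s' t : R) :
  (2 <= n)%N -> 0 <= s -> s < s' -> s' <= 1 -> 0 < t ->
  exists2 w, @in_interval R n s t w & ~~ in_interval s' t w.
Proof.
move=> n2 s0 ss' s1 t0.
pose l := Num.bound (s' - s)^-1; pose N := (n ^ l)%N.
have N_big : 1 < (s' - s) * N%:R.
  rewrite mulrC -ltr_pdivrMr ?subr_gt0 // mul1r.
  apply: (@lt_le_trans _ _ l%:R); last by rewrite ler_nat ltnW // ltn_expl.
  by apply: archi_boundP; rewrite invr_ge0 subr_ge0 ltW.
have N0 : 0 < N%:R :> R by rewrite ltr0n expn_gt0 ltnW.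
pose p := Num.truncn (s * N%:R).
have /andP[ps sp] : p%:R <= s * N%:R < p.+1%:R.
  by apply: truncn_itv; rewrite mulr_ge0 // ltW.
have [|w wl wp] := @base_value_surj n l p.
  rewrite -/N -(ltr_nat R); apply: le_lt_trans ps _.
  by rewrite gtr_pMl // (lt_le_trans ss').
exists w; rewrite /in_interval wl wp -/N.
  rewrite sp /=; apply: le_lt_trans ps _; rewrite ltr_pM2r //.
  by rewrite ltrDl.
rewrite negb_and -leNgt; apply/orP; left.
by rewrite -natr1; move: N_big; rewrite mulrBl; lra.
Qed.

Lemma in_interval_inj (R : realType) (n : nat) (s s' t : R) :
  (2 <= n)%N -> 0 <= s <= 1 -> 0 <= s' <= 1 -> 0 < t ->
  @in_interval R n s t =1 in_interval s' t -> s = s'.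
Proof.
move=> n2 /andP[s0 s1] /andP[s'0 s'1] t0 ss'.
have [lt|lt|//] := ltgtP s s'.
  by have [w] := in_interval_lt n2 s0 lt s'1 t0; rewrite ss' => ->.
by have [w] := in_interval_lt n2 s'0 lt s1 t0; rewrite ss' => ->.
Qed.

(** A countable set has Lebesgue measure 0. *)
Lemma itv_uncountable (R : realType) (a b : R) : a < b ->
  ~ countable [set: {s : R | a <= s <= b}].
Proof.
move=> ab cnt; pose A := [set` `[a, b]].
have cA : countable A.
  apply: (@sub_countable _ _ _ (sval @` [set: {s : R | a <= s <= b}])).
    apply: subset_card_le => s; rewrite /A /= in_itv /= => sab.
    by exists (exist _ s sab).
  by apply: card_le_trans cnt; apply: card_image_le.
have := countable_lebesgue_measure0 cA.
rewrite /A lebesgue_measure_itv /= lte_fin ab.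
by move=> /eqP; rewrite -EFinB eqe subr_eq0 gt_eqF.
Qed.

(** * The uncountable family *)

Theorem theorem2p6 (R : realType) (k : nat) (n : 'I_k -> nat)
    (hk : (2 <= k)%N) (hn : forall i, (2 <= n i)%N)
    (t : R) (ht : 0 < t < 1) :
  exists (Omega : Type) (T : Omega -> polyball R n),
    [/\ ~ countable [set: Omega],
        (forall omega, pure_tuple (T omega)),
        (forall omega sigma, omega <> sigma ->
           ~ unitarily_equivalent (T omega) (T sigma)) &
        (forall omega, rank (T omega) = 1%N /\
           has_euler_characteristic (T omega) t)].
Proof.
have /andP[t0 t1] := ht.
pose i0 : 'I_k := Ordinal (ltnW hk).
pose Omega := {s : R | 0 <= s <= 1 - t}.
have s_ge0 (omega : Omega) : 0 <= sval omega by case: omega => s /= /andP[].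
have st_le1 (omega : Omega) : sval omega + t <= 1.
  by case: omega => s /= /andP[_]; rewrite lerBrDr.
pose tree_of (omega : Omega) : tree (n i0) :=
  interval_tree (n i0) (s_ge0 omega) t0 (st_le1 omega).
exists Omega, (fun omega => Polyball (tree_tuple_polyball R (tree_of omega))).
split=> [|omega|omega sigma neq equiv|omega].
- by apply: itv_uncountable; rewrite subr_gt0.
- exact: tree_tuple_pure.
- apply: neq; have := tree_tuple_unitary_invariant equiv.
  have unit_s (om : Omega) : 0 <= sval om <= 1.
    by rewrite s_ge0 (le_trans _ (st_le1 om)) // lerDl ltW.
  move=> /(in_interval_inj (hn i0) (unit_s omega) (unit_s sigma) t0).
  exact: val_inj.
- split; first exact: rank_tree_tuple.
  by apply: tree_tuple_euler; apply: interval_tree_density.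
Qed.
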